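(* There is a universal constant $C>0$ such that the following holds. Consider the exponential family mixture model described in the context, let $\{\Delta_n\}_{n\ge 1}$ be positive tolerance levels, and let $\{M_n\}_{n\ge 1}$ be a sequence of positive numbers such that $$\mathrm{supp}(\hat g)\cup \mathrm{supp}(\hat g_{J_n})\subseteq [-M_n,M_n].$$ Assume that $|X|_n M_n\ge 1$. If $$J_n=\bigg\lceil 2|X|_nM_n\log\Big(\frac{Cn|X|_nM_n\big(|X|_nM_n+\sup_{|\theta|\le M_n}|\kappa(\theta)|\big)}{\Delta_n}\Big)\bigg\rceil ,$$ then $$\ell_n(f_{\hat g})-\ell_n(f_{\hat g_{J_n}})\le \Delta_n .$$
   Context: Exponential family mixture model. Let $p_0$ be a probability density on $\mathbb{R}$ with respect to a dominating measure $\mu$. Put $Z(\theta)=\int \exp(\theta x)p_0(x)\,\mathrm{d}\mu(x)$, $\kappa(\theta)=\log Z(\theta)$, $\Theta=\{\theta\in\mathbb{R}:Z(\theta)<\infty\}$, and $p_\theta(x)=\exp(\theta x-\kappa(\theta))p_0(x)$ for $\theta\in\Theta$. Let $M\in(0,\infty]$ be known with $\Theta_0=\{\theta\in\mathbb{R}:|\theta|\le M\}\subseteq\Theta$ (so $\Theta_0=\mathbb{R}$ if $M=\infty$), and let $\mathcal{G}$ be the set of probability distributions $g$ with $\mathrm{supp}(g)\subseteq\Theta_0$. For $g\in\mathcal{G}$ let $f_g(x)=\int p_\theta(x)\,\mathrm{d}g(\theta)$ and $l_g(x)=\int \exp(\theta x-\kappa(\theta))\,\mathrm{d}g(\theta)$,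 so that $f_g=l_g p_0$. The observations $X_1,\dots,X_n$ are i.i.d. with density $f_{g_0}$ for some $g_0\in\mathcal{G}$; almost surely $p_0(X_i)>0$ for all $i$, and statements about the sample are understood almost surely. Notation. $|X|_n=\max_{1\le i\le n}|X_i|$; $\ell_n(f)=\sum_{i=1}^n\log f(X_i)$; $P_n$ is the empirical measure of $X_1,\dots,X_n$; $\lceil x\rceil$ is the smallest integer $\ge x$. The NPMLE $\hat g$ is any maximizer of $\ell_n(f_g)$ over $g\in\mathcal{G}$. For a (possibly random) positive integer $J_n$, $P_{J_n}$ is the order-$J_n$ Gaussian quadrature rule for $P_n$, i.e. a discrete probability measure supported on at most $J_n$ points with the same first $2J_n-1$ moments as $P_n$ (it equals $P_n$ if $J_n$ is at least the number of distinct observations), and $\hat g_{J_n}$ is any maximizer of $\int\log l_g(x)\,\mathrm{d}P_{J_n}(x)$ over $g\in\mathcal{G}$. $J_n$ is always understood to be a (finite) positive integer. *)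

(* Defs.v *)
From HB Require Import structures.
From mathcomp Require Import all_boot all_order all_algebra.
From mathcomp Require Import all_classical all_reals all_analysis.
Set Implicit Arguments.
Unset Strict Implicit.
Unset Printing Implicit Defensive.
Import Order.TTheory GRing.Theory Num.Theory.
Import numFieldNormedType.Exports.
Local Open Scope classical_set_scope.
Local Open Scope ring_scope.

Definition msupport (R : realType) (g : probability (measurableTypeR R) R) :
    set R :=
  [set t : R | forall U : set R, open U -> U t -> (0 < g U)%E].

Definition is_density (R : realType)
    (mu : {measure set (measurableTypeR R) -> \bar R}) (p : R -> R) : Prop :=
  [/\ measurable_fun [set: measurableTypeR R] (p : measurableTypeR R -> R),
      (forall x, 0 <= p x) &
      (\int[mu]_x (p x)%:E = 1)%E].

Definition Zfun (R : realType)
    (mu : {measure set (measurableTypeR R) -> \bar R}) (p0 : R -> R) (t : R) :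
    \bar R :=
  (\int[mu]_x (expR (t * x) * p0 x)%:E)%E.

(* [kappa t = +oo] when [Zfun t = +oo]. *)
Definition kappa (R : realType)
    (mu : {measure set (measurableTypeR R) -> \bar R}) (p0 : R -> R) (t : R) :
    \bar R :=
  lne (Zfun mu p0 t).

Definition Theta (R : realType)
    (mu : {measure set (measurableTypeR R) -> \bar R}) (p0 : R -> R) : set R :=
  [set t | (Zfun mu p0 t < +oo)%E].

(* Outside [Theta] this is [expeR (-oo) = 0]; mixing distributions do not
   charge that set, so the value there is irrelevant. *)
Definition tilt (R : realType)
    (mu : {measure set (measurableTypeR R) -> \bar R}) (p0 : R -> R)
    (t x : R) : \bar R :=
  expeR ((t * x)%:E - kappa mu p0 t)%E.

Definition expfam (R : realType)
    (mu : {measure set (measurableTypeR R) -> \bar R}) (p0 : R -> R)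
    (t x : R) : \bar R :=
  (tilt mu p0 t x * (p0 x)%:E)%E.

Definition Theta0 (R : realType) (M : \bar R) : set R :=
  [set t : R | (`|t|%:E <= M)%E].

Definition mixing (R : realType) (M : \bar R) :
    set (probability (measurableTypeR R) R) :=
  [set g | msupport g `<=` Theta0 M].

Definition mixdens (R : realType)
    (mu : {measure set (measurableTypeR R) -> \bar R}) (p0 : R -> R)
    (g : probability (measurableTypeR R) R) (x : R) : \bar R :=
  (\int[g]_t expfam mu p0 t x)%E.

Definition mixratio (R : realType)
    (mu : {measure set (measurableTypeR R) -> \bar R}) (p0 : R -> R)
    (g : probability (measurableTypeR R) R) (x : R) : \bar R :=
  (\int[g]_t tilt mu p0 t x)%E.

Definition has_density (d : measure_display) (T : measurableType d)
    (R : realType) (P : probability T R)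
    (mu : {measure set (measurableTypeR R) -> \bar R}) (f : R -> \bar R)
    (X : {RV P >-> R}) : Prop :=
  forall A : set (measurableTypeR R), measurable A ->
    (distribution P X A = \int[mu]_(x in A) f x)%E.

Definition mutually_independent (d : measure_display) (T : measurableType d)
    (R : realType) (P : probability T R) (I : finType)
    (X : I -> {RV P >-> R}) : Prop :=
  forall (S : {set I}) (A : I -> set (measurableTypeR R)),
    (forall i, measurable (A i)) ->
    (P (\bigcap_(i in [set` S]) (X i @^-1` A i)) =
     \prod_(i in S) P (X i @^-1` A i))%E.

Definition iid_sample (d : measure_display) (T : measurableType d)
    (R : realType) (P : probability T R)
    (mu : {measure set (measurableTypeR R) -> \bar R}) (f : R -> \bar R)
    (n : nat) (X : 'I_n -> {RV P >-> R}) : Prop :=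
  mutually_independent X /\ forall i, has_density mu f (X i).

(* A realized sample is the sequence of the observed values, in order and with
   repetitions. *)
Definition absmax (R : realType) (s : seq R) : R :=
  \big[Num.max/0]_(x <- s) `|x|.

Definition loglik (R : realType) (s : seq R) (f : R -> \bar R) : \bar R :=
  (\sum_(x <- s) lne (f x))%E.

Definition empirical (R : realType) (s : seq R) :
    {measure set (measurableTypeR R) -> \bar R} :=
  mscale ((size s)%:R^-1)%:nng
    (msum (fun k => \d_(s`_k : measurableTypeR R)) (size s)).

Definition is_npmle (R : realType)
    (mu : {measure set (measurableTypeR R) -> \bar R}) (p0 : R -> R)
    (M : \bar R) (s : seq R) (g : probability (measurableTypeR R) R) : Prop :=
  mixing M g /\
  forall h, mixing M h ->
    (loglik s (mixdens mu p0 h) <= loglik s (mixdens mu p0 g))%E.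

(* The last condition follows from the first two and is stated for
   explicitness. *)
Definition is_gauss_quadrature (R : realType) (J : nat) (s : seq R)
    (Q : probability (measurableTypeR R) R) : Prop :=
  [/\ (exists r : seq R, (size r <= J)%N /\ Q [set` r] = 1%E),
      (forall k : nat, (1 <= k <= 2 * J - 1)%N ->
         (\int[Q]_x (x ^+ k)%:E = \int[empirical s]_x (x ^+ k)%:E)%E) &
      ((size (undup s) <= J)%N ->
         forall A : set (measurableTypeR R), measurable A ->
           Q A = empirical s A)].

Definition is_quad_npmle (R : realType)
    (mu : {measure set (measurableTypeR R) -> \bar R}) (p0 : R -> R)
    (M : \bar R) (Q g : probability (measurableTypeR R) R) : Prop :=
  mixing M g /\
  forall h, mixing M h ->
    (\int[Q]_x lne (mixratio mu p0 h x) <=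
     \int[Q]_x lne (mixratio mu p0 g x))%E.

Definition kappa_sup (R : realType)
    (mu : {measure set (measurableTypeR R) -> \bar R}) (p0 : R -> R) (m : R) :
    \bar R :=
  ereal_sup [set `|kappa mu p0 t|%E | t in [set t : R | `|t| <= m]].

(* Main.v *)
Require Import Defs.
From HB Require Import structures.
From mathcomp Require Import all_boot all_order all_algebra.
From mathcomp Require Import all_classical all_reals all_analysis.
From mathcomp Require Import ring lra zify.
From mathcomp Require Import complex measurable_realfun.
Set Implicit Arguments.
Unset Strict Implicit.
Unset Printing Implicit Defensive.
Import Order.TTheory GRing.Theory Num.Theory.
Import numFieldNormedType.Exports.
Local Open Scope classical_set_scope.
Local Open Scope ring_scope.
Local Notation Re := complex.Re.
Local Notation Im := complex.Im.

(** Since [ghatJ] maximizes the quadrature likelihood, [l_n(ghat) - l_n(ghatJ)]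
    is at most [n] times the sum of the errors of the quadrature rule on
    [ln l_ghat] and [ln l_ghatJ].  The rule is exact in degree [< 2J], and its
    nodes of positive weight lie in [[-X, X]], [X = |X|_n], so each error is at
    most twice the distance on [[-X, X]] from [ln l_g] to the polynomials of
    degree [< 2J].

    To bound this distance without complex analysis, let [a = X M], let [L]
    be the argument of the logarithm in the definition of [J], and let [q] be the
    polynomial obtained from [l_g] by cutting the exponential series after about
    [14 a + ln L] terms.  Then [q] is close to [l_g] on [[-X, X]],
    and [Re q > 0] on the Bernstein ellipse of parameter [rho = exp (1 / (3 a))],
    because that ellipse lies in the strip [|Im z| <= 1 / (2 M)].  Hence
    [ln |q|] is a constant plus a sum of [deg q] functions [ln |x - z_j|] with
    all [z_j] outside the ellipse, and the Chebyshev expansion of such a function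
    converges like [rho ^- (2J) <= L ^ (-4/3)]. *)

(** * The logarithm of a polynomial without zeros in a Bernstein ellipse *)

Section complex_facts.
Variable R : rcfType.
Implicit Types z w : R[i].
Import Normc.

(** The squared modulus is a real polynomial in the coordinates, so its logarithm can be
    differentiated without square roots. *)
Definition nsq z : R := Re z ^+ 2 + Im z ^+ 2.

Lemma nsq_normc z : nsq z = normc z ^+ 2.
Proof. by case: z => a b; rewrite /nsq /= sqr_sqrtr// addr_ge0// sqr_ge0. Qed.

Lemma nsqM z w : nsq (z * w) = nsq z * nsq w.
Proof. by rewrite !nsq_normc normcM exprMn. Qed.

Lemma nsq_real (x : R) : nsq x%:C%C = x ^+ 2.
Proof. by rewrite /nsq /= expr0n /= addr0. Qed.

Lemma normc_ge0 z : 0 <= normc z.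
Proof. by case: z => a b; rewrite /= sqrtr_ge0. Qed.

Lemma normcX z k : normc (z ^+ k) = normc z ^+ k.
Proof. by elim: k => [|k IH]; rewrite ?expr0 ?normc1// !exprS normcM IH. Qed.

Lemma normc_real (x : R) : normc x%:C%C = `|x|.
Proof. by rewrite /= expr0n /= addr0 sqrtr_sqr. Qed.

Lemma le_Re_normc z : `|Re z| <= normc z.
Proof.
case: z => a b /=; rewrite -sqrtr_sqr ler_sqrt ?addr_ge0 ?sqr_ge0//.
by rewrite lerDl sqr_ge0.
Qed.

Lemma ReD z w : Re (z + w) = Re z + Re w.
Proof. by case: z => ? ?; case: w. Qed.

Lemma ReN z : Re (- z) = - Re z.
Proof. by case: z. Qed.

Lemma ReZ (x : R) z : Re (x%:C%C * z) = x * Re z.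
Proof. by case: z => a b; rewrite /= mul0r subr0. Qed.

Lemma Re_sum n (F : 'I_n -> R[i]) : Re (\sum_(i < n) F i) = \sum_(i < n) Re (F i).
Proof.
elim: n F => [|n IH] F; first by rewrite !big_ord0.
by rewrite !big_ord_recr /= ReD IH.
Qed.

Lemma normc_sub1_ge (z : R[i]) : 1 - normc z <= normc (1 - z).
Proof.
rewrite lerBlDr.
have := le_normcD (1 - z : Rcomplex R) (z : Rcomplex R).
by rewrite /= subrK normc1.
Qed.

End complex_facts.

(** * Truncated logarithm series in the unit disc *)

Section log_series.
Variable R : realType.
Import Normc.

(* Mean value theorem for [t |-> ln |1 - t v|^2 + 2 Re \sum_k (t v)^k / k], whose
   derivative is [- 2 Re ((t v)^m v / (1 - t v))]. *)
Lemma ln_one_sub (v : R[i]) (r : R) (m : nat) : normc v <= r -> r < 1 ->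
  `|ln (nsq (1 - v)) + 2 * \sum_(k < m) Re (v ^+ k.+1) / k.+1%:R|
   <= 2 * r ^+ m.+1 / (1 - r).
Proof.
move=> vr r1.
(* On the segment from 0 to [v], both [|1 - t v|^2] and the truncated series are real polynomials in
   [t]. *)
pose p2 : {poly R} := 1 - (2 * Re v) *: 'X + nsq v *: 'X^2.
pose S : {poly R} := \sum_(k < m) (2 * Re (v ^+ k.+1) / k.+1%:R) *: 'X^(k.+1).
have r0 : 0 <= r by apply: le_trans vr; exact: normc_ge0.
have p2E t : p2.[t] = nsq (1 - t%:C%C * v).
  rewrite /p2 /nsq; case: v {vr p2 S} => a b /=; rewrite !hornerE /=.
  by rewrite /nsq /=; ring.
have u0 t : 0 <= t -> t <= 1 -> 1 - r <= normc (1 - t%:C%C * v).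
  move=> t0 t1; apply: le_trans (normc_sub1_ge _).
  rewrite lerD2l lerN2 normcM normc_real ger0_norm//.
  by apply: le_trans vr; rewrite ler_piMl// normc_ge0.
have p2gt0 t : 0 <= t -> t <= 1 -> 0 < p2.[t].
  move=> t0 t1; rewrite p2E nsq_normc exprn_gt0//.
  by apply: lt_le_trans (u0 _ t0 t1); rewrite subr_gt0.
pose dG t := p2.[t]^-1 * p2^`().[t] + S^`().[t].
have dGP (t : R) : 0 <= t -> t <= 1 ->
    is_derive t 1 (fun t : R => ln p2.[t] + S.[t]) (dG t).
  move=> t0 t1; apply: is_deriveD.
  exact: (is_derive1_comp (is_derive1_ln (p2gt0 _ t0 t1)) (is_derive_poly p2 t)).
have dGle t : 0 <= t -> t <= 1 -> `|dG t| <= 2 * r ^+ m.+1 / (1 - r).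
  move=> t0 t1.
  set u := 1 - t%:C%C * v.
  have un0 : u != 0.
    apply/eqP => ue; have := u0 _ t0 t1; rewrite -/u ue normc0.
    by rewrite leNgt subr_gt0 r1.
  have SE : S^`().[t] = 2 * Re (\sum_(k < m) v * (t%:C%C * v) ^+ k).
    rewrite Re_sum mulr_sumr /S raddf_sum /= horner_sum; apply: eq_bigr => k _.
    rewrite linearZ /= derivXn hornerE hornerMn hornerXn exprMn mulrCA -exprS.
    rewrite -rmorphXn /= ReZ.
    rewrite -[t ^+ k *+ _]mulr_natr -!mulrA; congr (2 * _).
    by rewrite [_ ^+ k * _]mulrC mulKf ?pnatr_eq0// mulrC.
  (* A finite geometric sum. Its term [v / u] cancels the logarithmic derivative of [p2], so only
     the remainder is left. *)
  have B : \sum_(k < m) v * (t%:C%C * v) ^+ k = v / u - v * (t%:C%C * v) ^+ m / u.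
    have g : u * \sum_(k < m) (t%:C%C * v) ^+ k = 1 - (t%:C%C * v) ^+ m.
      by rewrite -[RHS]opprB subrX1 -mulNr opprB.
    rewrite -mulr_sumr; apply: (mulIf un0).
    by rewrite mulrBl !mulfVK// -mulrA [_ * u]mulrC g mulrBr mulr1.
  have E : p2.[t]^-1 * p2^`().[t] = - (2 * Re (v / u)).
    have := p2gt0 _ t0 t1; rewrite p2E -/u.
    have -> : p2^`().[t] = - (2 * Re v) + 2 * t * nsq v.
      rewrite /p2 derivD derivB -polyC1 derivC !derivZ derivX derivXn /=.
      by rewrite !hornerE /=; ring.
    rewrite /u /nsq; case: (v) => a b /= h.
    field. move: h; rewrite lt0r => /andP[+ _].
    by rewrite !mul0r subr0 addr0 add0r.
  rewrite /dG E SE B ReD ReN.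
  have -> : - (2 * Re (v / u)) + 2 * (Re (v / u) - Re (v * (t%:C%C * v) ^+ m / u))
    = - (2 * Re (v * (t%:C%C * v) ^+ m / u)) by ring.
  rewrite normrN normrM ger0_norm// -[2 * r ^+ _ / _]mulrA ler_wpM2l//.
  apply: le_trans (le_Re_normc _) _.
  rewrite !normcM normcV ler_pM ?mulr_ge0 ?normc_ge0 ?invr_ge0 ?normc_ge0//.
    rewrite normcX normcM exprS ler_pM ?exprn_ge0 ?mulr_ge0 ?normc_ge0//.
    rewrite lerXn2r ?nnegrE ?mulr_ge0 ?normc_ge0//.
    rewrite normc_real ger0_norm//.
    by apply: le_trans vr; rewrite ler_piMl// normc_ge0.
  by rewrite lef_pV2 ?posrE ?subr_gt0 ?(lt_le_trans _ (u0 _ t0 t1)) ?subr_gt0// u0.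
have [||c c01] := @MVT_segment R (fun t : R => ln p2.[t] + S.[t]) dG 0 1 ler01.
- move=> t; rewrite in_itv /= => /andP[t0 t1]; exact: dGP (ltW t0) (ltW t1).
- apply: derivable_within_continuous => t; rewrite in_itv /= => /andP[t0 t1].
  by have [] := dGP _ t0 t1.
have -> : ln p2.[0] + S.[0] = 0.
  rewrite /p2 !hornerE /= horner_sum big1 ?addr0.
    by rewrite !(mulr0, subr0, expr0n) /= ?mulr0 ?addr0 ?ln1.
  by move=> i _; rewrite !hornerE /= expr0n mulr0.
rewrite p2E mul1r subr0 subr0 mulr1 => GE.
have -> : 2 * \sum_(k < m) Re (v ^+ k.+1) / k.+1%:R = S.[1].
  rewrite /S horner_sum mulr_sumr; apply: eq_bigr => i _.
  by rewrite hornerZ hornerXn expr1n mulr1 mulrA.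
rewrite GE; move: c01; rewrite in_itv /= => /andP[c0 c1]; exact: dGle.
Qed.

End log_series.

(** * The Joukowski map and Chebyshev expansions *)

Section chebyshev.
Variable R : realType.
Import Normc.
Implicit Types z w : R[i].

(** On the unit circle, [Re z^(k+2) = 2 Re z Re z^(k+1) - Re z^k], so the induction carries two
    consecutive degrees. [T] is the Chebyshev polynomial of degree [k]. *)
Lemma chebyshev_poly (k : nat) : exists T : {poly R},
  (size T <= k.+1)%N /\ forall z, nsq z = 1 -> T.[Re z] = Re (z ^+ k).
Proof.
suff: (exists T : {poly R},
  (size T <= k.+1)%N /\ forall z, nsq z = 1 -> T.[Re z] = Re (z ^+ k)) /\
  (exists T : {poly R},
  (size T <= k.+2)%N /\ forall z, nsq z = 1 -> T.[Re z] = Re (z ^+ k.+1)) by case.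
elim: k => [|k [[T [sT TE]] [U [sU UE]]]]; split.
- by exists 1; split=> [|z _]; rewrite ?size_poly1// hornerE.
- by exists 'X; split=> [|z _]; rewrite ?size_polyX// hornerX.
- by exists U.
exists (2 *: 'X * U - T); split=> [|z z1].
  rewrite (leq_trans (size_polyD _ _))// geq_max size_polyN.
  apply/andP; split; last by rewrite (leq_trans sT)// leqW.
  rewrite -scalerAl (leq_trans (size_scale_leq _ _))//.
  by rewrite (leq_trans (size_polyMleq _ _))// size_polyX.
rewrite !hornerE UE// TE// [in RHS]exprS !exprS.
have -> : - Re (z ^+ k) = - (nsq z * Re (z ^+ k)) by rewrite z1 mul1r.
case: z {z1} => a b; case: (_ ^+ k) => c d; rewrite /nsq /=; ring.
Qed.

(** With [q] a square root of [s^2 - 1], the numbers [s + q] and [s - q] are inverse to each other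
    and have mean [s]; one of them has modulus at least 1. *)
Lemma joukowski_surj (s : R[i]) : exists2 w, 1 <= normc w & s = (w + w^-1) / 2.
Proof.
set q := sqrtc (s ^+ 2 - 1).
have q2 : q ^+ 2 = s ^+ 2 - 1 by rewrite sqr_sqrtc.
have sq1 : (s + q) * (s - q) = 1.
  by rewrite mulrC -subr_sqr q2 opprB addrCA subrr addr0.
have sV : (s + q)^-1 = s - q by apply: mulr1_eq; rewrite sq1.
have sV' : (s - q)^-1 = s + q by apply: mulr1_eq; rewrite mulrC sq1.
have n2 : (2 : R[i]) != 0 by rewrite pnatr_eq0.
have [h|h] := lerP 1 (normc (s + q)).
  by exists (s + q) => //; rewrite sV; field.
exists (s - q); last by rewrite sV'; field.
rewrite -sV normcV invf_ge1 ?ltW// lt_neqAle normc_ge0 eq_sym andbT.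
apply/eqP => /eq0_normc s0; move: sq1; rewrite s0 mul0r => /eqP.
by rewrite eq_sym oner_eq0.
Qed.

(** Since [w^-1 = conj w / |w|^2], adding the inverse multiplies the real part by [1 + |w|^-2] and
    the imaginary part by [1 - |w|^-2]. This encloses the Bernstein ellipse in a rectangle. *)
Lemma joukowski_bound w (rho : R) : 1 <= normc w -> normc w <= rho ->
  `|Re ((w + w^-1) / 2)| <= rho /\ `|Im ((w + w^-1) / 2)| <= (rho - rho^-1) / 2.
Proof.
move=> w1 wr.
have w0 : 0 < normc w by rewrite (lt_le_trans _ w1).
have r0 : 0 < rho by rewrite (lt_le_trans w0).
have wn0 : w != 0 by apply: contraTneq w0 => ->; rewrite normc0 ltxx.
have VE : w^-1 = (normc w ^- 2)%:C%C * (w^*)%C.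
  rewrite -nsq_normc; apply: (mulfI wn0); rewrite mulfV//.
  have : nsq w != 0 by rewrite nsq_normc expf_neq0// gt_eqF.
  rewrite /nsq; case: (w) => a b /= n0.
  apply/eqP; rewrite eq_complex /=; apply/andP; split; apply/eqP; last by ring.
  by field.
have h2 z : Re (z / 2) = Re z / 2 /\ Im (z / 2) = Im z / 2.
  have -> : z / 2 = (2^-1)%:C%C * z by rewrite mulrC fmorphV rmorph_nat.
  by case: z => a b /=; split; ring.
rewrite !(h2 _).1 !(h2 _).2.
have V1 : (normc w)^-1 <= 1 by rewrite invf_le1.
have V2 : rho^-1 <= (normc w)^-1 by rewrite lef_pV2.
have [Rw Iw] : `|Re w| <= normc w /\ `|Im w| <= normc w.
  split; first exact: le_Re_normc.
  case: (w) => a b /=; rewrite -sqrtr_sqr ler_sqrt ?addr_ge0 ?sqr_ge0//.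
  by rewrite lerDr sqr_ge0.
have E : Re (w + w^-1) = Re w * (1 + normc w ^- 2) /\
         Im (w + w^-1) = Im w * (1 - normc w ^- 2).
  rewrite VE; case: (w) => a b /=; split; ring.
have V0 : 0 <= normc w ^- 2 by rewrite invr_ge0 exprn_ge0// normc_ge0.
have V21 : normc w ^- 2 <= 1 by rewrite invf_le1 ?exprn_gt0// exprn_ege1.
rewrite E.1 E.2; split.
  rewrite !normrM [`|2^-1|]ger0_norm// [`|1 + _|]ger0_norm ?addr_ge0//.
  rewrite ler_pdivrMr// ler_pM ?addr_ge0//; first exact: le_trans Rw wr.
  by rewrite (natrD _ 1 1) lerD2l.
rewrite !normrM [`|2^-1|]ger0_norm// [`|1 - _|]ger0_norm ?subr_ge0//.
rewrite ler_pM2r//.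
apply: (@le_trans _ _ (normc w * (1 - normc w ^- 2))).
  by rewrite ler_wpM2r ?subr_ge0.
rewrite mulrBr mulr1 -exprVn expr2 mulrA mulfV ?gt_eqF// mul1r.
by rewrite lerB.
Qed.

(** Write [x = X Re zt] with [|zt| = 1]. The distance factors into a constant, [|1 - zt / w|] and
    [|1 - conj zt / w|], and [ln_one_sub] applies to the last two with [r = rho^-1]. As [Re (zt/w)^k
    + Re (conj zt/w)^k = 2 Re zt^k Re w^-k], the two truncated series add up to a Chebyshev sum in
    [x / X]. *)
Lemma ln_dist_approx (X rho : R) (w : R[i]) (m : nat) :
  0 < X -> 1 < rho -> rho <= normc w ->
  exists p : {poly R}, (size p <= m.+1)%N /\
    forall x, `|x| <= X ->
      let d := nsq (x%:C%C - X%:C%C * ((w + w^-1) / 2)) in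
      0 < d /\ `|ln d - p.[x]| <= 4 * rho ^- m.+1 / (1 - rho^-1).
Proof.
move=> X0 r1 rw.
have r0 : 0 < rho by rewrite (lt_trans _ r1).
have w0 : 0 < normc w by rewrite (lt_le_trans r0).
have wn0 : w != 0 by apply: contraTneq w0 => ->; rewrite normc0 ltxx.
have rV1 : rho^-1 < 1 by rewrite invf_lt1.
have /choice [T TP] := chebyshev_poly.
pose p : {poly R} := (ln (X ^+ 2 * nsq w / 4))%:P -
  \sum_(k < m) (4 * Re (w ^- k.+1) / k.+1%:R) *: (T k.+1 \Po (X^-1 *: 'X)).
exists p; split.
  rewrite (leq_trans (size_polyD _ _))// geq_max size_polyN.
  rewrite (leq_trans (size_polyC_leq1 _))//=.
  apply: (leq_trans (size_sum _ _ _)); apply/bigmax_leqP => k _.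
  rewrite (leq_trans (size_scale_leq _ _))//.
  rewrite (leq_trans (size_comp_poly_leq _ _))//.
  have -> : size (X^-1 *: 'X : {poly R}) = 2%N.
    by rewrite size_scale ?size_polyX// invr_eq0 gt_eqF.
  rewrite muln1 ltnS (leq_trans _ (ltn_ord k))//.
  by have [+ _] := TP k.+1; case: size.
move=> x xX d.
pose c := x / X.
have c1 : `|c| <= 1.
  by rewrite /c normrM normfV (gtr0_norm X0) ler_pdivrMr// mul1r.
pose zt : R[i] := Complex c (Num.sqrt (1 - c ^+ 2)).
have zt1 : nsq zt = 1.
  rewrite /nsq /= sqr_sqrtr; first by ring.
  by rewrite subr_ge0 -real_normK ?num_real// expr_le1.
have Rz : Re zt = c by [].
have ztJ1 : nsq (zt^*)%C = 1 by rewrite -zt1 /nsq /= sqrrN.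
clearbody zt.
have nzt z : nsq z = 1 -> normc (z / w) <= rho^-1.
  rewrite nsq_normc => /eqP; rewrite sqrp_eq1 ?normc_ge0// => /eqP nz1.
  by rewrite normcM normcV nz1 mul1r lef_pV2.
have nzt0 z : nsq z = 1 -> 0 < nsq (1 - z / w).
  move=> z1; rewrite nsq_normc exprn_gt0//.
  apply: lt_le_trans (normc_sub1_ge _).
  by rewrite subr_gt0 (le_lt_trans (nzt _ z1)).
have L1 := ln_one_sub m (nzt _ zt1) rV1.
have L2 := ln_one_sub m (nzt _ ztJ1) rV1.
(* [x - z = - (X w / 2) (1 - zt / w) (1 - conj zt / w)], as [x = X Re zt]. *)
have dE : d = X ^+ 2 * nsq w / 4 * nsq (1 - zt / w) * nsq (1 - (zt^*)%C / w).
  have -> : X ^+ 2 * nsq w / 4 = nsq ((X / 2)%:C%C * w).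
    by rewrite nsqM nsq_real; field.
  have nsqN z : nsq (- z) = nsq z by case: z => a b; rewrite /nsq /= !sqrrN.
  rewrite -!nsqM /d -nsqN; congr nsq.
  have -> : x%:C%C = X%:C%C * ((zt + (zt^*)%C) / 2).
    rewrite addcJ Rz mulrAC mulfV ?pnatr_eq0// mul1r -rmorphM /= /c.
    by rewrite mulrC mulfVK// gt_eqF.
  have ztJ : zt * (zt^*)%C = 1.
    rewrite (_ : 1 = (nsq zt)%:C%C); last by rewrite zt1.
    case: (zt) => a b; rewrite /nsq /=; apply/eqP; rewrite eq_complex /=.
    by apply/andP; split; apply/eqP; ring.
  rewrite rmorphM fmorphV rmorph_nat.
  transitivity (X%:C%C / 2 * (w - (zt + (zt^*)%C) + zt * (zt^*)%C * w^-1)).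
    by rewrite ztJ; field.
  by field.
have d0 : 0 < X ^+ 2 * nsq w / 4.
  by rewrite divr_gt0// mulr_gt0 ?exprn_gt0// nsq_normc exprn_gt0.
split; first by rewrite dE; do 2 (apply: mulr_gt0; last exact: nzt0).
have ln3 (a b e : R) : 0 < a -> 0 < b -> 0 < e ->
    ln (a * b * e) = ln a + ln b + ln e.
  by move=> *; rewrite !lnM ?posrE ?mulr_gt0.
rewrite dE ln3 ?nzt0//.
have pE : p.[x] = ln (X ^+ 2 * nsq w / 4)
   - 2 * \sum_(k < m) Re ((zt / w) ^+ k.+1) / k.+1%:R
   - 2 * \sum_(k < m) Re (((zt^*)%C / w) ^+ k.+1) / k.+1%:R.
  rewrite /p !hornerE horner_sum -addrA -opprD -mulrDr; congr (_ - _).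
  rewrite -big_split /= mulr_sumr; apply: eq_bigr => k _.
  have Tz : (T k.+1).[X^-1 * x] = Re (zt ^+ k.+1).
    by rewrite -(TP _).2// Rz mulrC.
  rewrite hornerZ horner_comp hornerZ hornerX Tz -mulrDl -ReD.
  rewrite !exprMn -mulrDl -rmorphXn addcJ exprVn.
  have -> : 2 * (Re (zt ^+ k.+1))%:C%C / w ^+ k.+1 =
     (2 * Re (zt ^+ k.+1))%:C%C * w ^- k.+1 by rewrite rmorphM rmorph_nat.
  by rewrite ReZ; ring.
rewrite pE.
set e := 4 * _ / _.
have -> : e = 2 * rho^-1 ^+ m.+1 / (1 - rho^-1) + 2 * rho^-1 ^+ m.+1 / (1 - rho^-1).
  by rewrite /e exprVn; ring.
apply: le_trans (lerD L1 L2); apply: le_trans (ler_normD _ _).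
by rewrite le_eqVlt; apply/orP; left; apply/eqP; congr `|_|; ring.
Qed.

End chebyshev.

(** * Polynomials without zeros in the ellipse *)

Section poly_log.
Variable R : realType.
Import Normc.

(** Over [R[i]] the polynomial splits. Each root is [X] times a Joukowski image of some [w] with
    [|w| >= 1], and the hypothesis forces [|w| >= rho], so [ln_dist_approx] applies root by root. *)
Lemma ln_poly_approx (X rho : R) (q : {poly R}) (m : nat) :
  0 < X -> 1 < rho -> q != 0 ->
  (forall w : R[i], 1 <= normc w -> normc w < rho ->
     (map_poly (real_complex R) q).[X%:C%C * ((w + w^-1) / 2)] != 0) ->
  exists p : {poly R}, (size p <= m.+1)%N /\
    forall x, `|x| <= X ->
      `|ln `|q.[x]| - p.[x]| <= (size q).-1%:R * (2 * rho ^- m.+1 / (1 - rho^-1)).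
Proof.
move=> X0 r1 q0 nz.
set e := 2 * _ / _.
have [rs qE] := closed_field_poly_normal (map_poly (real_complex R) q).
have lq0 : lead_coef q != 0 by rewrite lead_coef_eq0.
have qCE x : (map_poly (real_complex R) q).[x%:C%C] = (q.[x])%:C%C.
  by rewrite horner_map.
rewrite lead_coef_map in qE.
have srs : size rs = (size q).-1.
  have := size_map_poly (real_complex R) q.
  rewrite qE size_scale; last by rewrite fmorph_eq0.
  by rewrite size_prod_XsubC => <-.
have rsP z : z \in rs -> exists2 w, rho <= normc w & z = X%:C%C * ((w + w^-1) / 2).
  move=> zrs; have [w w1 zE] := joukowski_surj (z / X%:C%C).
  have {}zE : z = X%:C%C * ((w + w^-1) / 2).
    by rewrite -zE mulrC mulfVK// fmorph_eq0 gt_eqF.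
  exists w => //; rewrite leNgt; apply/negP => /(nz _ w1)/eqP; apply.
  rewrite -zE qE hornerZ horner_prod (big_rem z)//= hornerXsubC subrr mul0r mulr0 //.
have [p [sp pP]] : exists p : {poly R}, (size p <= m.+1)%N /\
    forall x, `|x| <= X ->
      let d := \prod_(z <- rs) nsq (x%:C%C - z) in
      0 < d /\ `|ln d - p.[x]| <= (size rs)%:R * (2 * e).
  elim: rs rsP {qE srs} => [|z rs IH] rsP.
    exists 0; split; first by rewrite size_poly0.
    by move=> x _ /=; rewrite big_nil ln1 horner0 subrr normr0 mul0r.
  have [z' z'rs|p [sp pP]] := IH; first by apply: rsP; rewrite inE z'rs orbT.
  have [|w wr zE] := rsP z; first exact: mem_head.
  have [p1 [sp1 p1P]] := ln_dist_approx m X0 r1 wr.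
  exists (p1 + p); split.
    by rewrite (leq_trans (size_polyD _ _))// geq_max sp1.
  move=> x xX /=; rewrite big_cons.
  have [d0 dP] := pP _ xX; have := p1P _ xX; rewrite -zE => -[d10 d1P].
  split; first exact: mulr_gt0.
  rewrite lnM ?posrE// hornerD opprD addrACA -natr1 mulrDl mul1r addrC.
  apply: (le_trans (ler_normD _ _)); rewrite lerD//.
  apply: le_trans d1P _; rewrite /e.
  by rewrite le_eqVlt; apply/orP; left; apply/eqP; ring.
(* The products above are squared moduli; the factor 1/2 passes from [ln q(x)^2] to [ln |q(x)|]. *)
exists (2^-1 *: (p + (ln (lead_coef q ^+ 2))%:P)); split.
  rewrite (leq_trans (size_scale_leq _ _))// (leq_trans (size_polyD _ _))//.
  by rewrite geq_max sp (leq_trans (size_polyC_leq1 _)).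
move=> x xX; have [d0 dP] := pP _ xX; rewrite -srs.
have q2 : q.[x] ^+ 2 = lead_coef q ^+ 2 * \prod_(z <- rs) nsq (x%:C%C - z).
  rewrite -nsq_real -qCE qE hornerZ nsqM nsq_real horner_prod; congr (_ * _).
  elim: (rs) => [|z r IH]; first by rewrite !big_nil /nsq /= expr0n addr0 expr1n.
  by rewrite !big_cons nsqM IH hornerXsubC.
have l20 : 0 < lead_coef q ^+ 2 by rewrite exprn_even_gt0.
have qx0 : 0 < `|q.[x]|.
  rewrite normr_gt0; apply: contraTneq d0 => q0'.
  move: q2; rewrite q0' expr0n /= => /esym/eqP; rewrite mulf_eq0 gt_eqF//= => /eqP ->.
  by rewrite ltxx.
have -> : ln `|q.[x]| = 2^-1 * (ln (lead_coef q ^+ 2) +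
    ln (\prod_(z <- rs) nsq (x%:C%C - z))).
  rewrite -lnM ?posrE// -q2 -real_normK ?num_real// lnXn//.
  by field.
rewrite hornerZ hornerD hornerC.
have -> (a b c : R) : 2^-1 * (a + b) - 2^-1 * (c + a) = 2^-1 * (b - c) by ring.
rewrite normrM ger0_norm// ler_pdivrMl//; apply: le_trans dP _.
by rewrite le_eqVlt; apply/orP; left; apply/eqP; ring.
Qed.

End poly_log.

(** * Truncated exponential series *)

(** The field is left general because the sum is needed over both [R] and [R[i]]. *)
Definition texp (K : numFieldType) (D : nat) (x : K) : K :=
  \sum_(k < D) x ^+ k / k`!%:R.

Section texp_product.
Variables (K : numFieldType) (D : nat).
Implicit Types x y : K.

(** A formal variable records the degree; setting it to 1 gives back [texp]. *)
Let texp_poly x : {poly K} := \poly_(i < D) (x ^+ i / i`!%:R).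

Let texp_poly1 x : (texp_poly x).[1] = texp D x.
Proof.
by rewrite horner_poly; apply: eq_bigr => i _; rewrite expr1n mulr1.
Qed.

Let coef_texpM x y k : (k < D)%N ->
  (texp_poly x * texp_poly y)`_k = (x + y) ^+ k / k`!%:R.
Proof.
move=> kD; rewrite coefMr exprDn mulr_suml; apply: eq_bigr => i _.
have ik : (i <= k)%N by rewrite -ltnS.
rewrite !coef_poly (leq_ltn_trans (leq_subr _ _) kD) (leq_ltn_trans ik kD).
rewrite -(bin_fact ik) -mulr_natr !natrM.
have h n : (n`!%:R : K) != 0 by rewrite pnatr_eq0 -lt0n fact_gt0.
have hb : ('C(k, i)%:R : K) != 0 by rewrite pnatr_eq0 -lt0n bin_gt0.
by field; rewrite !h hb.
Qed.

Let texpM_tail x y :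
  texp D x * texp D y - texp D (x + y) =
  \sum_(D <= k < D + D) (texp_poly x * texp_poly y)`_k.
Proof.
rewrite -!texp_poly1 -hornerM.
rewrite (@horner_coef_wide _ (D + D)); last first.
  rewrite (leq_trans (size_polyMleq _ _))// (leq_trans (leq_pred _))//.
  by rewrite leq_add// size_poly.
under eq_bigr do rewrite expr1n mulr1.
rewrite -(big_mkord xpredT (fun k => (texp_poly x * texp_poly y)`_k)).
rewrite (@big_cat_nat _ _ _ D)//= ?leq_addr// texp_poly1 /texp.
rewrite big_mkord (eq_bigr (fun k : 'I_D => (x + y) ^+ k / k`!%:R)); last first.
  by move=> k _; rewrite coef_texpM.
by rewrite addrAC subrr add0r.
Qed.

(** By the binomial theorem the product and [texp D (x + y)] agree below degree [D]. The difference
    is thus a polynomial in [x] and [y] with nonnegative coefficients, and the triangle inequality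
    replaces [x] and [y] by their moduli. *)
Lemma norm_texpM_sub_le x y :
  `|texp D x * texp D y - texp D (x + y)| <=
  texp D `|x| * texp D `|y| - texp D (`|x| + `|y|).
Proof.
rewrite !texpM_tail; apply: le_trans (ler_norm_sum _ _ _) _.
apply: ler_sum => k _; rewrite !coefM; apply: le_trans (ler_norm_sum _ _ _) _.
apply: ler_sum => i _; rewrite normrM ler_pM// coef_poly coef_poly;
  case: ifP => _; rewrite ?normr0//.
  by rewrite normrM normrX normfV normr_nat.
by rewrite normrM normrX normfV normr_nat.
Qed.

Lemma norm_texp_sub1_le x : (0 < D)%N -> `|texp D x - 1| <= texp D `|x| - 1.
Proof.
case: D => // n _; rewrite /texp !big_ord_recl /= !expr0 fact0 divr1.
rewrite addrAC subrr add0r [leRHS]addrAC subrr add0r.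
apply: le_trans (ler_norm_sum _ _ _) _.
by apply: ler_sum => i _; rewrite normrM normrX normfV normr_nat.
Qed.

End texp_product.

(** * Truncation error, and positivity of the real part in a strip *)

Section texp_real.
Variable R : realType.
Implicit Types x u v a : R.
Import Normc.

Lemma texpE D x : texp D x = series (exp_coeff x) D.
Proof. by rewrite /texp seriesEord. Qed.

Lemma cvg_texp x : (fun D => texp D x) @ \oo --> expR x.
Proof.
rewrite (_ : (fun D => texp D x) = series (exp_coeff x)); last first.
  by apply/funext => D; rewrite texpE.
exact: is_cvg_series_exp_coeff.
Qed.

Lemma texp_le_expR D x : 0 <= x -> texp D x <= expR x.
Proof.
move=> x0; rewrite texpE; apply: nondecreasing_cvgn_le.
  apply/nondecreasing_seqP => n; rewrite -!texpE /texp big_ord_recr /= lerDl.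
  by rewrite divr_ge0// exprn_ge0.
exact: is_cvg_series_exp_coeff.
Qed.

(** From [expR (- 1/4) >= 3/4], inverted and squared. The bound has to stay below 2 for
    [Re_texp_ge]. *)
Lemma expR_half_le : expR (2^-1 : R) <= 16 / 9.
Proof.
have h : expR (4^-1 : R) <= 4 / 3.
  have := expR_ge1Dx (- 4^-1 : R); rewrite expRN => h.
  rewrite -[expR _]invrK -[4 / 3]invrK lef_pV2 ?posrE ?invr_gt0 ?expR_gt0//.
  by apply: le_trans h; lra.
rewrite (_ : 2^-1 = 4^-1 + 4^-1 :> R); last by field.
rewrite expRD (_ : 16 / 9 = (4 / 3) * (4 / 3) :> R); last by field.
by rewrite ler_pM ?expR_ge0.
Qed.

Lemma expR1_le4 : expR (1 : R) <= 4.
Proof.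
rewrite (_ : 1 = 2^-1 + 2^-1 :> R); last by field.
rewrite expRD; have := expR_half_le; have := expR_gt0 (2^-1 : R); nra.
Qed.

(** For [k >= D] the factor [e^(k - D)] is at least 1, so the tail is at most [e^(-D)] times the
    series of [expR (e |x|)], and [e <= 4]. This is shown for finite sections of the tail and passed
    to the limit. *)
Lemma expR_sub_texp_le D x : `|expR x - texp D x| <= expR (4 * `|x| - D%:R).
Proof.
have h N : (D <= N)%N -> `|texp N x - texp D x| <= expR (4 * `|x| - D%:R).
  move=> DN.
  have E : texp N x - texp D x = \sum_(D <= k < N) x ^+ k / k`!%:R.
    rewrite /texp -!(big_mkord xpredT (fun k => x ^+ k / k`!%:R)).
    by rewrite (@big_cat_nat _ _ _ D 0 N)//= addrAC subrr add0r.
  rewrite E; apply: le_trans (ler_norm_sum _ _ _) _.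
  apply: (@le_trans _ _ (expR (- D%:R) * texp N (expR 1 * `|x|))); last first.
    rewrite addrC expRD ler_wpM2l ?expR_ge0//.
    apply: (@le_trans _ _ (expR (expR 1 * `|x|))).
      by apply: texp_le_expR; rewrite mulr_ge0 ?expR_ge0.
    by rewrite ler_expR ler_wpM2r// expR1_le4.
  rewrite /texp mulr_sumr -(big_mkord xpredT
    (fun k => expR (- D%:R) * ((expR 1 * `|x|) ^+ k / k`!%:R))).
  rewrite (@big_cat_nat _ _ _ D 0 N)//= -[leLHS]add0r lerD//.
    by apply: sumr_ge0 => i _; rewrite mulr_ge0 ?expR_ge0// divr_ge0//
         exprn_ge0// mulr_ge0 ?expR_ge0.
  rewrite big_nat_cond [leRHS]big_nat_cond; apply: ler_sum => i /andP[/andP[Di _] _].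
  rewrite normrM normrX normfV normr_nat exprMn -expRM_natl mulr1.
  rewrite !mulrA ler_wpM2r ?invr_ge0// ler_peMl ?exprn_ge0// -expRD.
  rewrite -[leLHS]expR0 ler_expR; have : (D%:R <= i%:R :> R) by rewrite ler_nat.
  by lra.
have c : (fun N => `|texp N x - texp D x|) @ \oo --> `|expR x - texp D x|.
  by apply: cvg_norm; apply: cvgB; [exact: cvg_texp|exact: cvg_cst].
have <- := cvg_lim (@Rhausdorff R) c.
apply: limr_le; first by apply: cvgP c.
by near=> N; apply: h; near: N; exact: nbhs_infty_ge.
Unshelve. all: by end_near. Qed.

(* [texp D (u + i v)] is close to [texp D u * texp D (i v)]; the first factor is
   about [expR u], the second is within [expR `|v| - 1 <= 7 / 9] of [1]. *)
Lemma Re_texp_ge (D : nat) (a u v : R) : 1 <= a -> 14 * a <= D%:R ->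
  `|u| <= 3 / 2 * a -> `|v| <= 2^-1 ->
  expR (8 * a - D%:R) / 2 <= Re (texp D (Complex u v)).
Proof.
move=> a1 aD ua v2.
have rE (r : R) : texp D (r%:C%C) = (texp D r)%:C%C.
  rewrite /texp rmorph_sum; apply: eq_bigr => i _.
  by rewrite rmorphM rmorphXn fmorphV rmorph_nat.
pose y : R[i] := Complex 0 v.
have uvE : Complex u v = u%:C%C + y.
  by apply/eqP; rewrite eq_complex /= addr0 add0r !eqxx.
have nu : `|u%:C%C| = `|u|%:C%C by rewrite normc_def /= expr0n addr0 sqrtr_sqr.
have ny : `|y| = `|v|%:C%C by rewrite normc_def /= expr0n add0r sqrtr_sqr.
have := norm_texpM_sub_le D (u%:C%C) y.
rewrite -uvE nu ny -rmorphD /= !rE -rmorphM -rmorphB /= => h1.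
have {}h1 : `|Re ((texp D u)%:C%C * texp D y - texp D (Complex u v))| <=
    texp D `|u| * texp D `|v| - texp D (`|u| + `|v|).
  apply: le_trans (le_Re_normc _) _.
  by rewrite -lecR; apply: le_trans h1; rewrite normc_def; case: (_ - _).
have D0 : (0 < D)%N by rewrite -(ltr_nat R); lra.
have h2 : 2 / 9 <= Re (texp D y).
  have := norm_texp_sub1_le y D0; rewrite ny rE => h2.
  have : `|Re (texp D y - 1)| <= texp D `|v| - 1.
    apply: le_trans (le_Re_normc _) _.
    rewrite -lecR rmorphB rmorph1; apply: le_trans h2.
    by rewrite normc_def; case: (_ - _).
  have : texp D `|v| <= 16 / 9.
    apply: le_trans (texp_le_expR _ _) _ => //.
    by apply: le_trans expR_half_le; rewrite ler_expR.
  rewrite ReD ReN /= ler_norml => hv /andP[]; lra.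
have t8 : `|u| + `|v| <= 2 * a by lra.
(* As [|u| + |v| <= 2 a], this [t] bounds both truncation errors, that of the product formula and
   that of [texp D u]. *)
set t := expR (8 * a - D%:R).
have h3 : texp D `|u| * texp D `|v| - texp D (`|u| + `|v|) <= t.
  have := expR_sub_texp_le D (`|u| + `|v|).
  rewrite [`|(`|u| + `|v|)|]ger0_norm ?addr_ge0//.
  move=> /(le_trans (ler_norm (expR _ - _))) h.
  apply: (@le_trans _ _ (expR (`|u| + `|v|) - texp D (`|u| + `|v|))).
    rewrite lerB// expRD ler_pM ?texp_le_expR//.
      by apply: sumr_ge0 => i _; rewrite divr_ge0// exprn_ge0.
    by apply: sumr_ge0 => i _; rewrite divr_ge0// exprn_ge0.
  by apply: le_trans h _; rewrite ler_expR; lra.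
have h4 : expR (- (3 / 2 * a)) - t <= texp D u.
  have := expR_sub_texp_le D u; rewrite ler_norml => /andP[_ h].
  have : expR (4 * `|u| - D%:R) <= t by rewrite ler_expR; lra.
  have : expR (- (3 / 2 * a)) <= expR u.
    by rewrite ler_expR; move: ua; rewrite ler_norml => /andP[]; lra.
  by lra.
rewrite -/t.
(* Here [14 a <= D] enters: [D - 8 a - 3 a / 2 >= 9 / 2] and [expR (9 / 2) >= (5 / 2)^3 > 9]. The
   product is then at least [8 t * 2 / 9], which exceeds the error [t] by more than [t / 2]. *)
have h5 : 9 * t < expR (- (3 / 2 * a)).
  rewrite -lter_pdivlMr ?expR_gt0// /t -expRN -expRD.
  have e32 : 5 / 2 <= expR (3 / 2 : R) by apply: le_trans (expR_ge1Dx _); lra.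
  apply: (@lt_le_trans _ _ (expR (3 / 2 * 3%:R))).
    by rewrite expRM_natr !exprS expr0; nra.
  by rewrite ler_expR; lra.
have t0 : 0 < t by exact: expR_gt0.
have h6 : (expR (- (3 / 2 * a)) - t) * (2 / 9) <= texp D u * Re (texp D y).
  by rewrite ler_pM//; lra.
have comb (b c k w z : R) : b - w <= k -> k <= z -> 9 * z < c ->
    (c - z) * (2 / 9) <= b -> 0 < z -> z / 2 <= w by move=> *; lra.
move: h1; rewrite ReD ReN ReZ ler_norml => /andP[_ h1].
exact: comb h1 h3 h5 h6 t0.
Qed.

End texp_real.

(** * Approximation and quadrature errors *)

Section ln_approx.
Variable R : realType.
Import Normc.

(** Turns a relative error into an error of logarithms, using [d / (1 - d) <= 2 d]. The modulus of
    [y] appears because [ln_poly_approx] controls [ln |q|]. *)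
Lemma ln_ratio_le (x y d : R) : 0 < x -> 0 <= d -> d <= 2^-1 ->
  `|x - y| <= d * x -> `|ln x - ln `|y| | <= 2 * d.
Proof.
move=> x0 d0 d2 xyd.
have yx : (1 - d) * x <= `|y| <= (1 + d) * x.
  have := ler_normD (x - y) y; have := ler_normD (y - x) x.
  rewrite !subrK distrC (gtr0_norm x0) => ? ?.
  apply/andP; split; lra.
have d1 : 0 < 1 - d by lra.
have y0 : 0 < `|y|.
  by case/andP: yx => + _; apply: lt_le_trans; rewrite mulr_gt0.
have -> : ln x - ln `|y| = - ln (`|y| / x).
  by rewrite ln_div ?posrE// opprB.
rewrite normrN ler_norml; apply/andP; split; last first.
  apply: (@le_trans _ _ (ln (1 + d))).
    rewrite ler_ln ?posrE ?divr_gt0//; last by lra.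
    by rewrite ler_pdivrMr//; case/andP: yx.
  by apply: le_trans (le_ln1Dx _) _; lra.
apply: (@le_trans _ _ (ln (1 - d))); last first.
  by rewrite ler_ln ?posrE ?divr_gt0// ler_pdivlMr//; case/andP: yx.
rewrite lerNl -lnV ?posrE//.
have -> : (1 - d)^-1 = 1 + d / (1 - d) by field; lra.
apply: le_trans (le_ln1Dx _) _.
  by apply: (@lt_le_trans _ _ 0); [lra|rewrite divr_ge0// ltW].
rewrite ler_pdivrMr//; nra.
Qed.

(** Take [rho = expR (1 / (3 a))]. The ellipse scaled by [X] lies in the zero-free rectangle
    [|Re z| <= 3 X / 2], [|Im z| <= 1 / (2 M)]. The two error terms come from replacing [l] by [q]
    and from approximating [ln |q|]. *)
Lemma ln_poly_approx_strip (X M : R) (D m : nat) (q : {poly R}) (l : R -> R) :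
  0 < X -> 0 < M -> 1 <= X * M -> 14 * (X * M) <= D%:R -> (size q <= D)%N ->
  (forall x, `|x| <= X ->
     0 < l x /\ `|l x - q.[x]| <= expR (5 * (X * M) - D%:R) * l x) ->
  (forall z : R[i], `|Re z| * M <= 3 / 2 * (X * M) -> `|Im z| * M <= 2^-1 ->
     (map_poly (real_complex R) q).[z] != 0) ->
  exists p : {poly R}, (size p <= m.+1)%N /\
    forall x, `|x| <= X ->
      `|ln (l x) - p.[x]| <= 2 * expR (5 * (X * M) - D%:R) +
         D%:R * (8 * (X * M) * expR (- (m.+1%:R / (3 * (X * M))))).
Proof.
move=> X0 M0; set a := X * M => a1 aD sq lP qn0.
have a0 : 0 < a by lra.
pose s := (3 * a)^-1.
have s0 : 0 < s by rewrite invr_gt0 mulr_gt0.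
have s3 : s <= 3^-1 by rewrite lef_pV2 ?posrE ?mulr_gt0//; lra.
pose rho := expR s.
have r1 : 1 < rho by rewrite expR_gt1.
have r0 : 0 < rho by exact: expR_gt0.
have rV : 1 - s <= rho^-1 by rewrite -expRN; apply: expR_ge1Dx.
have s1 : 0 < 1 - s by lra.
have rU : rho <= (1 - s)^-1 by rewrite -[rho]invrK lef_pV2 ?posrE// invr_gt0.
have rs : rho <= 1 + 3 / 2 * s.
  (* For [s <= 1/3], [1 / (1 - s) <= 1 + 3 s / 2]. *)
  by apply: le_trans rU _; rewrite -[leLHS]mul1r ler_pdivrMr//; nra.
have r32 : rho <= 3 / 2 by lra.
have r34 : (rho - rho^-1) / 2 <= 3 / 2 * s by lra.
have sa : s * a = 3^-1 by rewrite /s; field; lra.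
have q0 : q != 0.
  apply/eqP => q0; have := qn0 0; rewrite q0 map_poly0 horner0 eqxx.
  by rewrite /= normr0 mul0r => h; suff: false by []; apply: h; lra.
have [w w1 wr|p [sp pP]] := @ln_poly_approx R X rho q m X0 r1 q0.
  have [h1 h2] := joukowski_bound w1 (ltW wr).
  apply: qn0.
    rewrite ReZ normrM (gtr0_norm X0) mulrAC -/a mulrC.
    by rewrite ler_wpM2r ?(ltW a0)// (le_trans h1).
  have -> (z : R[i]) : Im (X%:C%C * z) = X * Im z.
    by case: z => ? ? /=; rewrite mul0r addr0.
  rewrite normrM (gtr0_norm X0) mulrAC -/a.
  apply: (@le_trans _ _ (a * (3 / 2 * s))).
    by rewrite ler_wpM2l ?(ltW a0)// (le_trans h2).
  by nra.
exists p; split => // x xX.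
have [lx0 lqx] := lP _ xX.
have e2 : expR (5 * a - D%:R) <= 2^-1.
  rewrite -[expR _]invrK lef_pV2 ?posrE ?invr_gt0 ?expR_gt0// -expRN.
  by apply: le_trans (expR_ge1Dx _); lra.
have := ln_ratio_le lx0 (expR_ge0 _) e2 lqx => h1.
have h2 := pP _ xX.
apply: le_trans (ler_distD (ln `|q.[x]|) _ _) _; rewrite lerD//.
apply: le_trans h2 _.
apply: ler_pM => //.
- by rewrite divr_ge0 ?subr_ge0 ?invf_le1 ?(ltW r1)// divr_ge0// exprn_ge0// ltW.
- by rewrite ler_nat (leq_trans (leq_pred _)).
have -> : rho ^- m.+1 = expR (- (m.+1%:R / (3 * a))).
  by rewrite /rho -expRM_natl -expRN /s.
(* From [rho >= 1 + s] the left side is at most [1 + 1 / s = 3 a + 1], and [a >= 1]. *)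
have h3 : (1 - rho^-1)^-1 <= 4 * a.
  have rV2 : rho^-1 <= (1 + s)^-1 by rewrite lef_pV2 ?posrE ?expR_ge1Dx//; lra.
  have : 1 - (1 + s)^-1 = (3 * a + 1)^-1.
    by rewrite /s; field; apply/andP; split; lra.
  move=> h4; rewrite -[4 * a]invrK lef_pV2 ?posrE ?invr_gt0; last 2 first.
  - by rewrite subr_gt0 invf_lt1.
  - lra.
  apply: (@le_trans _ _ (3 * a + 1)^-1); last by lra.
  by rewrite lef_pV2 ?posrE; lra.
rewrite -mulrA [_ * (1 - _)^-1]mulrC mulrA ler_wpM2r ?expR_ge0//.
by lra.
Qed.

End ln_approx.

(** * Quadrature rules exact in degree below [2 * J] *)

Section quadrature.
Variable R : realType.
Variables (r s : seq R) (W : R -> R) (J : nat).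
Hypotheses (r_uniq : uniq r) (r_size : (size r <= J)%N) (s0 : (0 < size s)%N).
Hypothesis W0 : forall y, 0 <= W y.
Hypothesis moments : forall k, (k < 2 * J)%N ->
  \sum_(y <- r) W y * y ^+ k = (size s)%:R^-1 * \sum_(x <- s) x ^+ k.

Lemma quad_exact (p : {poly R}) : (size p <= 2 * J)%N ->
  \sum_(y <- r) W y * p.[y] = (size s)%:R^-1 * \sum_(x <- s) p.[x].
Proof.
move=> sp.
transitivity (\sum_(k < size p) p`_k * \sum_(y <- r) W y * y ^+ k).
  under [RHS]eq_bigr do rewrite mulr_sumr.
  rewrite exchange_big /=; apply: eq_bigr => y _.
  rewrite horner_coef mulr_sumr; apply: eq_bigr => k _; ring.
transitivity (\sum_(k < size p) p`_k * ((size s)%:R^-1 * \sum_(x <- s) x ^+ k)).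
  by apply: eq_bigr => k _; rewrite moments// (leq_trans (ltn_ord k)).
under eq_bigr do rewrite mulrCA mulr_sumr.
rewrite -mulr_sumr exchange_big /=; congr (_ * _); apply: eq_bigr => x _.
by rewrite horner_coef.
Qed.

(* A node [y > X] is excluded by testing the rule against
   [(X - x) \prod_(t != y) (x - t)^2], which has degree at most [2 J - 1]. *)
Lemma quad_node_le (X : R) : {in s, forall x, `|x| <= X} ->
  forall y, y \in r -> 0 < W y -> `|y| <= X.
Proof.
(* The sign [c] treats both ends of the interval at once. *)
have one_sided (c : R) : (c = 1) \/ (c = -1) -> {in s, forall x, c * x <= X} ->
    forall y, y \in r -> 0 < W y -> c * y <= X.
  move=> cN sX y yr Wy; rewrite leNgt; apply/negP => Xy.
  pose p : {poly R} := (X%:P - c *: 'X) * (\prod_(t <- rem y r) ('X - t%:P)) ^+ 2.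
  have szp : (size p <= 2 * J)%N.
    rewrite (leq_trans (size_polyMleq _ _))// -subn1 leq_subLR.
    have h1 : (size (X%:P - c *: 'X)%R <= 2)%N.
      rewrite (leq_trans (size_polyD _ _))// geq_max size_polyN.
      rewrite (leq_trans (size_polyC_leq1 _))//.
      by rewrite (leq_trans (size_scale_leq _ _)) ?size_polyX.
    apply: leq_trans (leq_add h1 (size_poly_exp_leq _ _)) _.
    rewrite size_prod_XsubC /= size_rem//.
    have : (0 < size r)%N by case: (r) yr.
    by move: r_size; case: (size r) => // k; lia.
  have pE x : p.[x] = (X - c * x) * (\prod_(t <- rem y r) (x - t)) ^+ 2.
    rewrite /p hornerM horner_exp hornerD hornerN hornerC hornerZ hornerX horner_prod.
    congr (_ * _ ^+ 2).
    by apply: eq_bigr => t _; rewrite hornerXsubC.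
  (* The test polynomial vanishes at every node but [y], where it is negative, and it is nonnegative
     on the sample: the two means cannot agree. *)
  have := quad_exact szp.
  rewrite (big_rem y yr)/= [X in _ + X]big_seq_cond big1 ?addr0; last first.
    move=> t /andP[tr _]; rewrite pE (big_rem t tr)/= subrr mul0r expr0n/=.
    by rewrite !mulr0.
  move=> E.
  have : W y * p.[y] < 0.
    rewrite pmulr_rlt0// pE nmulr_rlt0 ?subr_lt0//.
    rewrite exprn_even_gt0//= prodf_seq_neq0; apply/allP => t.
    by rewrite mem_rem_uniq// inE subr_eq0 eq_sym => /andP[].
  have : 0 <= (size s)%:R^-1 * \sum_(x <- s) p.[x].
    rewrite mulr_ge0// big_seq; apply: sumr_ge0 => x xs.
    by rewrite pE mulr_ge0 ?sqr_ge0// subr_ge0 sX.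
  by rewrite E; lra.
move=> sX y yr Wy; rewrite ler_norml lerNl -mulN1r -[y in _ && (y <= _)]mul1r.
rewrite !one_sided//; [by left| |by right|] => x /sX; rewrite ler_norml;
  by case/andP => ? ?; lra.
Qed.

(** Both means agree on [p], so [f] may be replaced by [f - p]; each mean then contributes at most
    [e], since both have total mass 1. *)
Lemma quad_error_le (X e : R) (f : R -> R) (p : {poly R}) :
  \sum_(y <- r) W y = 1 ->
  {in s, forall x, `|x| <= X} -> (size p <= 2 * J)%N ->
  (forall x, `|x| <= X -> `|f x - p.[x]| <= e) ->
  `|\sum_(y <- r) W y * f y - (size s)%:R^-1 * \sum_(x <- s) f x| <= 2 * e.
Proof.
move=> W1 sX sp fp.
have n0 : 0 < (size s)%:R :> R by rewrite ltr0n.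
have -> : \sum_(y <- r) W y * f y - (size s)%:R^-1 * \sum_(x <- s) f x =
  \sum_(y <- r) W y * (f y - p.[y]) - (size s)%:R^-1 * \sum_(x <- s) (f x - p.[x]).
  under [X in _ = X - _]eq_bigr do rewrite mulrBr.
  by rewrite !sumrB quad_exact// mulrBr opprB addrA subrK.
apply: le_trans (ler_normB _ _) _.
rewrite (_ : 2 * e = e + e); last by ring.
apply: lerD.
  apply: le_trans (ler_norm_sum _ _ _) _.
  rewrite -[e]mul1r -W1 mulr_suml big_seq [leRHS]big_seq; apply: ler_sum => y yr.
  rewrite normrM (ger0_norm (W0 y)).
  (* A node of weight zero may lie outside [[- X, X]], where [f - p] is not controlled. *)
  have := W0 y; rewrite le_eqVlt => /predU1P[<-|Wy]; first by rewrite !mul0r.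
  by rewrite ler_wpM2l// fp// (quad_node_le sX).
rewrite normrM normfV (gtr0_norm n0) ler_pdivrMl//.
apply: le_trans (ler_norm_sum _ _ _) _.
apply: (@le_trans _ _ (\sum_(x <- s) e)).
  by rewrite big_seq [leRHS]big_seq; apply: ler_sum => x xs; rewrite fp// sX.
by rewrite big_const_seq count_predT iter_addr_0 mulr_natl.
Qed.

End quadrature.

(** * Choice of the constants *)

Section tolerance.
Variable R : realType.

(** With [y = ln L], the lower bound on [D] gives [expR (5 a - D) <= L^-1], and the one on [J] gives
    [L^-1 expR (- y / 3)] for the second exponential. The surplus [expR (- y / 3)] absorbs the
    growth of [D <= a (15 + y)]. *)
Lemma tolerance_le (n D J : nat) (a K Delta : R) :
  let L := 600 * n%:R * a * (a + K) / Delta in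
  (0 < n)%N -> 1 <= a -> 0 <= K -> 0 < Delta -> 1 < L ->
  14 * a + ln L <= D%:R -> D%:R <= 15 * a + ln L -> 2 * a * ln L <= J%:R ->
  n%:R * (4 * (2 * expR (5 * a - D%:R) +
     D%:R * (8 * a * expR (- ((2 * J)%:R / (3 * a)))))) <= Delta.
Proof.
move=> L n0 a1 K0 D0 L1 aD Da aJ.
have L0 : 0 < L by lra.
have a0 : 0 < a by lra.
have nR : 0 < n%:R :> R by rewrite ltr0n.
set y := ln L in aD Da aJ.
have y0 : 0 < y by rewrite /y ln_gt0.
have LE : L^-1 = expR (- y) by rewrite expRN /y lnK ?posrE.
have h1 : expR (5 * a - D%:R) <= L^-1.
  by rewrite LE ler_expR; lra.
have h2 : expR (- ((2 * J)%:R / (3 * a))) <= L^-1 * expR (- (y / 3)).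
  rewrite LE -expRD ler_expR natrM -opprD lerN2 ler_pdivlMr ?mulr_gt0//; nra.
have h3 : y * expR (- (y / 3)) <= 3.
  rewrite expRN ler_pdivrMr ?expR_gt0//.
  have := expR_ge1Dx (y / 3); lra.
have h4 : expR (- (y / 3)) <= 1 by rewrite -[leRHS]expR0 ler_expR; lra.
have LV : 0 < L^-1 by rewrite invr_gt0.
have h5 : D%:R * (8 * a * expR (- ((2 * J)%:R / (3 * a)))) <= 144 * a ^+ 2 * L^-1.
  apply: (@le_trans _ _ (a * (15 + y) * (8 * a * (L^-1 * expR (- (y / 3)))))).
    rewrite ler_pM ?mulr_ge0 ?expR_ge0 ?(ltW a0)//; first by nra.
    by rewrite ler_wpM2l// mulr_ge0// ltW.
  have -> : a * (15 + y) * (8 * a * (L^-1 * expR (- (y / 3)))) =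
    (8 * a ^+ 2 * L^-1) * (15 * expR (- (y / 3)) + y * expR (- (y / 3))) by ring.
  have -> : 144 * a ^+ 2 * L^-1 = (8 * a ^+ 2 * L^-1) * 18 by ring.
  rewrite ler_wpM2l ?mulr_ge0 ?sqr_ge0 ?(ltW LV)//; lra.
(* [584 = 4 * (2 + 144)], which the constant 600 in [L] covers. *)
apply: (@le_trans _ _ (584 * n%:R * a ^+ 2 * L^-1)).
  have -> : 584 * n%:R * a ^+ 2 * L^-1 = n%:R * (4 * (146 * a ^+ 2 * L^-1)) by ring.
  rewrite ler_wpM2l// ler_wpM2l//.
  have : 2 * expR (5 * a - D%:R) <= 2 * a ^+ 2 * L^-1.
    have : 1 <= a ^+ 2 by rewrite exprn_ege1.
    move=> a2; nra.
  move: h5; set u := _ * (_ * _); lra.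
have LD : Delta * L = 600 * n%:R * a * (a + K) by rewrite /L mulrC mulfVK// gt_eqF.
rewrite ler_pdivrMr// LD.
have -> : 600 * n%:R * a * (a + K) = 600 * (n%:R * a ^+ 2) + 600 * (n%:R * a * K) by ring.
have : 0 <= n%:R * a ^+ 2 by rewrite mulr_ge0// sqr_ge0.
have : 0 <= n%:R * a * K by rewrite mulr_ge0// mulr_ge0// ltW.
lra.
Qed.

End tolerance.

(** * Measures and mixtures *)

Section measure_aux.
Variable R : realType.
Implicit Types (g : probability (measurableTypeR R) R).

Lemma measurable_expeR : measurable_fun [set: \bar R] (@expeR R).
Proof.
have -> : @expeR R = fun x => if x == +oo%E then +oo%E else
    if x == -oo%E then 0%E else (expR (fine x))%:E.
  by apply/funext; case.
apply: measurable_fun_ifT => //.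
  apply: (measurable_fun_bool true); rewrite setTI.
  have -> : (fun x : \bar R => x == +oo%E) @^-1` [set true] = [set +oo%E].
    by apply/seteqP; split=> x /= => [/eqP|->].
  exact: emeasurable_set1.
apply: measurable_fun_ifT => //.
  apply: (measurable_fun_bool true); rewrite setTI.
  have -> : (fun x : \bar R => x == -oo%E) @^-1` [set true] = [set -oo%E].
    by apply/seteqP; split=> x /= => [/eqP|->].
  exact: emeasurable_set1.
apply/measurable_EFinP; apply: measurableT_comp; first exact: measurable_expR.
exact: fine_measurable.
Qed.

Lemma measurable_lne : measurable_fun [set: \bar R] (@lne R).
Proof.
have -> : @lne R = fun x => if x == +oo%E then +oo%E else
    if (x <= 0)%E then -oo%E else (ln (fine x))%:E.
  by apply/funext => -[r| |]; rewrite /= ?lee_fin ?leNye.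
apply: measurable_fun_ifT => //.
  apply: (measurable_fun_bool true); rewrite setTI.
  have -> : (fun x : \bar R => x == +oo%E) @^-1` [set true] = [set +oo%E].
    by apply/seteqP; split=> x /= => [/eqP|->].
  exact: emeasurable_set1.
apply: measurable_fun_ifT => //.
  apply: (measurable_fun_bool true); rewrite setTI.
  have -> : (fun x : \bar R => (x <= 0)%E) @^-1` [set true] = `]-oo, 0%E]%classic.
    by apply/seteqP; split=> x; rewrite /= in_itv.
  exact: emeasurable_itv.
apply/measurable_EFinP; apply: measurableT_comp; first exact: measurable_ln.
exact: fine_measurable.
Qed.

(** A point outside the support has a null open neighbourhood, hence lies in a null interval with
    rational endpoints, and there are countably many of these; [F] enumerates them. *)
Lemma msupport_null g (m : R) : msupport g `<=` `[- m, m] ->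
  g (~` `[- m, m]%classic) = 0%E.
Proof.
move=> gm.
pose I (pq : rat * rat) : set R := `]ratr pq.1, ratr pq.2[%classic.
pose F (k : nat) : set (measurableTypeR R) :=
  if unpickle k is Some pq then if g (I pq) == 0%E then I pq else set0 else set0.
have mI pq : measurable (I pq : set (measurableTypeR R)) by exact: measurable_itv.
have F0 k : g.-negligible (F k).
  rewrite /F; case: unpickle => [pq|]; last exact: negligible_set0.
  case: ifPn => [/eqP h|_]; last exact: negligible_set0.
  by apply/negligibleP.
apply/negligibleP; first by apply: measurableC; exact: measurable_itv.
apply: negligibleS (negligible_bigcup F0) => t /= tm.
have : ~ msupport g t by move/gm.
move=> /existsNP[U /not_implyP[oU /not_implyP[Ut /negP gU]]].
rewrite -leNgt measure_le0 in gU.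
have := open_nbhs_nbhs (conj oU Ut) => /nbhs_ballP[e /= e0 eU].
have /rat_in_itvoo[p] : t - e < t by rewrite ltrBlDr ltrDl.
rewrite in_itv /= => /andP[p1 p2].
have /rat_in_itvoo[q] : t < t + e by rewrite ltrDl.
rewrite in_itv /= => /andP[q1 q2].
have Fpq : F (pickle (p, q)) = I (p, q).
  rewrite /F pickleK ifT//.
  rewrite -measure_le0 -(eqP gU) le_measure ?inE//.
    by apply: open_measurable.
  move=> x; rewrite /I /= in_itv /= => /andP[px xq]; apply: eU.
  by rewrite /ball /= ltr_distlC; apply/andP; split; lra.
exists (pickle (p, q)); first exact: Logic.I.
by rewrite Fpq /I /= in_itv /= p2 q1.
Qed.

Lemma integral_conull d (T : measurableType d) (P : {measure set T -> \bar R})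
  (A : set T) (f : T -> \bar R) : measurable A -> P (~` A) = 0%E ->
  measurable_fun [set: T] f ->
  (\int[P]_x f x = \int[P]_(x in A) f x)%E.
Proof.
move=> mA A0 mf; rewrite -[in LHS](setUv A) integral_setU//.
- rewrite [X in (_ + X)%E]null_set_integral ?adde0//; first exact: measurableC.
  exact: measurable_funTS.
- exact: measurableC.
- by rewrite setUv.
- by apply/disj_set2P; rewrite setICr.
Qed.

Lemma integral_finite_support (Q : probability (measurableTypeR R) R) (r : seq R)
    (f : R -> \bar R) : uniq r -> Q [set` r] = 1%E ->
  measurable_fun [set: measurableTypeR R] (f : measurableTypeR R -> \bar R) ->
  (forall y, y \in r -> f y \is a fin_num) ->
  (\int[Q]_x f x = (\sum_(y <- r) fine (Q [set y]) * fine (f y))%:E)%E.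
Proof.
move=> ur Qr mf ffin.
have mr : measurable ([set` r] : set (measurableTypeR R)).
  by apply: countable_measurable => //; apply: finite_set_countable; exact: finite_seq.
have rE : \big[setU/set0]_(y <- r) [set y] = [set` r] :> set R.
  by rewrite -bigcup_seq; apply/seteqP; split=> [x [y /= yr ->]//|x xr]; exists x.
transitivity (\int[Q]_(x in [set` r]) f x)%E.
  apply: integral_conull => //; have := probability_setC Q mr.
  by rewrite Qr subee.
transitivity (\int[Q]_(x in [set` r]) (fine (f x))%:E)%E.
  by apply: eq_integral => x; rewrite inE => xr; rewrite fineK// ffin.
rewrite -rE (@integral_bigsetU_EFin _ (measurableTypeR R) R Q R (fun y => [set y]))//.
- rewrite -sumEFin big_seq [RHS]big_seq; apply: eq_bigr => y yr.
  transitivity (\int[Q]_(x in [set y]) (cst (fine (f y))%:E) x)%E.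
    by apply: eq_integral => x; rewrite inE => ->.
  rewrite integral_cst// EFinM !fineK ?ffin ?fin_num_measure//.
  exact: muleC.
- by move=> x y _ _ [z [-> ->]].
- by apply/measurable_EFinP; apply/measurable_funTS; apply: measurableT_comp => //;
    exact: fine_measurable.
Qed.

(** The rules for sums and multiples of measures are applied to nonnegative integrands, so positive
    and negative parts are treated apart. *)
Lemma integral_empirical (s : seq R) (f : R -> R) :
  measurable_fun [set: measurableTypeR R] (f : measurableTypeR R -> R) ->
  (\int[empirical s]_x (f x)%:E = ((size s)%:R^-1 * \sum_(x <- s) f x)%:E)%E.
Proof.
move=> mf.
have pos (h : R -> \bar R) :
    measurable_fun [set: measurableTypeR R] (h : measurableTypeR R -> \bar R) ->
    (forall x, 0 <= h x)%E ->
    (\int[empirical s]_x h x = (size s)%:R^-1%:E * \sum_(x <- s) h x)%E.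
  move=> mh h0; rewrite /empirical ge0_integral_mscale//=.
  rewrite ge0_integral_measure_sum//; congr (_ * _)%E.
  rewrite (big_nth 0) big_mkord; apply: eq_bigr => i _.
  by rewrite integral_dirac// diracT mul1e.
have mE : measurable_fun [set: measurableTypeR R]
    (EFin \o f : measurableTypeR R -> \bar R).
  exact/measurable_EFinP.
rewrite integralE !pos//; [|exact: measurable_funeneg|exact: measurable_funepos].
have -> : (\sum_(x <- s) ((fun x => (f x)%:E)^\+)%E x =
    (\sum_(x <- s) Num.max (f x) 0)%:E)%E.
  by rewrite -sumEFin; apply: eq_bigr => x _; rewrite funeposE EFin_max.
have -> : (\sum_(x <- s) ((fun x => (f x)%:E)^\-)%E x =
    (\sum_(x <- s) Num.max (- f x) 0)%:E)%E.
  by rewrite -sumEFin; apply: eq_bigr => x _; rewrite funenegE EFin_max.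
rewrite -!EFinM -EFinB -mulrBr -sumrB; congr (_ * _)%:E; apply: eq_bigr => x _.
by rewrite /Num.max; case: ltrP => ?; case: ltrP => ?; lra.
Qed.

End measure_aux.

Lemma continuous_sum_ord (R : realType) (D : nat) (f : nat -> R -> R) :
  (forall k, continuous (f k)) -> continuous (fun t => \sum_(k < D) f k t).
Proof.
move=> cf; elim: D => [|D IH].
  by under eq_fun do rewrite big_ord0; exact: cst_continuous.
under eq_fun do rewrite big_ord_recr.
by move=> t; apply: cvgD; [exact: IH|exact: cf].
Qed.

(** * Measurability in the exponential family *)

Section exponential_family.
Variables (R : realType) (mu : {measure set (measurableTypeR R) -> \bar R}).
Variable p0 : R -> R.
Hypothesis p0_density : is_density mu p0.

Let mp0 : measurable_fun [set: measurableTypeR R] (p0 : measurableTypeR R -> R).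
Proof. by case: p0_density. Qed.

Let p0_ge0 x : 0 <= p0 x.
Proof. by case: p0_density. Qed.

Let mexp (t : R) :
  measurable_fun [set: measurableTypeR R]
    ((fun x => expR (t * x)) : measurableTypeR R -> R).
Proof.
apply: measurableT_comp; first exact: measurable_expR.
by apply: measurable_funM => //; exact: measurable_cst.
Qed.

Let mZ (t : R) : measurable_fun [set: measurableTypeR R]
  ((fun x => (expR (t * x) * p0 x)%:E) : measurableTypeR R -> \bar R).
Proof. by apply/measurable_EFinP; exact: measurable_funM. Qed.

(* Fatou's lemma. As [mu] need not be sigma-finite, the measurability of [kappa]
   cannot come from Fubini's theorem. *)
Lemma lower_semicontinuous_Zfun : lower_semicontinuous (Zfun mu p0).
Proof.
move=> t a aZ; apply: contrapT => H0.
(* If the claim fails, some [u n] tend to [t] with [Zfun mu p0 (u n) <= a]; Fatou's lemma then gives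
   the same bound at [t]. *)
have H (n : nat) : exists u : R, `|t - u| < n.+1%:R^-1 /\ (Zfun mu p0 u <= a%:E)%E.
  apply: contrapT => H; apply: H0; exists (ball t n.+1%:R^-1).
    by apply: nbhsx_ballx; rewrite invr_gt0.
  move=> u tu; rewrite ltNge; apply/negP => ua; apply: H; exists u.
  by split.
have /choice[u uP] := H.
have ut : u @ \oo --> t.
  apply/cvgrPdist_lt => e e0; near=> n.
  apply: lt_le_trans (uP n).1 _; apply: ltW.
  by near: n; exact: near_infty_natSinv_lt (PosNum e0).
move: aZ; rewrite ltNge => /negP; apply.
have -> : Zfun mu p0 t =
    (\int[mu]_x limn_einf ((fun n x => (expR (u n * x) * p0 x)%:E)^~ x))%E.
  apply: eq_integral => x _; symmetry; apply: (cvg_limn_einf_sup _).1.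
  apply: cvg_EFin; first by near=> n.
  apply: cvgM; last exact: cvg_cst.
  apply: continuous_cvg; first exact: continuous_expR.
  by apply: cvgM => //; exact: cvg_cst.
apply: le_trans (fatou _ _ _ _) _ => //.
  by move=> n x _; rewrite lee_fin mulr_ge0// expR_ge0.
rewrite limn_einf_lim; apply: lime_le; first exact: is_cvg_einfs.
near=> n; apply: le_trans (uP n).2; apply: ereal_inf_lbound.
by exists n => //=.
Unshelve. all: by end_near. Qed.

Lemma measurable_kappa :
  measurable_fun [set: measurableTypeR R] (kappa mu p0 : measurableTypeR R -> \bar R).
Proof.
apply: measurableT_comp; first exact: measurable_lne.
exact: lower_semicontinuous_measurable lower_semicontinuous_Zfun.
Qed.

Lemma measurable_tilt (x : R) :
  measurable_fun [set: measurableTypeR R]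
    ((tilt mu p0)^~ x : measurableTypeR R -> \bar R).
Proof.
apply: measurableT_comp; first exact: measurable_expeR.
apply: emeasurable_funB; last exact: measurable_kappa.
apply/measurable_EFinP; apply: measurable_funM => //; exact: measurable_cst.
Qed.

Lemma tilt_ge0 t x : (0 <= tilt mu p0 t x)%E.
Proof. exact: expeR_ge0. Qed.

Lemma mixdensE (g : probability (measurableTypeR R) R) (x : R) :
  mixdens mu p0 g x = (mixratio mu p0 g x * (p0 x)%:E)%E.
Proof.
rewrite /mixdens /mixratio -ge0_integralZr ?lee_fin//.
- exact: measurable_tilt.
- by move=> t _; exact: tilt_ge0.
Qed.

(** The density [l_g p0] vanishes wherever [p0] does, even if [l_g] is infinite there, so [X] avoids
    the zero set of [p0] almost surely. *)
Lemma has_density_p0_gt0 d (Omega : measurableType d) (P : probability Omega R)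
    (g : probability (measurableTypeR R) R) (X : {RV P >-> R}) :
  has_density mu (mixdens mu p0 g) X -> {ae P, forall w, 0 < p0 (X w)}.
Proof.
move=> dX; pose A : set (measurableTypeR R) := p0 @^-1` [set 0].
have mA : measurable A by rewrite -[A]setTI; apply: mp0 => //; exact: measurable_set1.
have := dX A mA; rewrite integral0_eq; last first.
  by move=> x px; rewrite mixdensE px mule0.
move=> PA; exists (X @^-1` A); split => //.
  by rewrite -[_ @^-1` _]setTI; exact: measurable_funPT.
by move=> w /= /negP; rewrite lt_def p0_ge0 andbT negbK => /eqP.
Qed.

(** * Mixing distributions supported in [[- m, m]] *)

Section bounded_mixing.
Variables (m : R) (g : probability (measurableTypeR R) R).
Hypotheses (m0 : 0 < m) (gm : msupport g `<=` `[- m, m]).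
Hypothesis kfin : kappa_sup mu p0 m \is a fin_num.
Let K := fine (kappa_sup mu p0 m).
Let A : set (measurableTypeR R) := `[- m, m]%classic.
Let e (t : R) := expR (- fine (kappa mu p0 t)).

Let mA : measurable A. Proof. exact: measurable_itv. Qed.

Let A_le t : A t -> `|t| <= m.
Proof. by rewrite /A /= in_itv /= ler_norml. Qed.

Lemma kappa_le t : `|t| <= m ->
  kappa mu p0 t \is a fin_num /\ `|fine (kappa mu p0 t)| <= K.
Proof.
move=> tm.
have h : (`|kappa mu p0 t| <= K%:E)%E.
  by rewrite /K fineK//; apply: ereal_sup_ubound; exists t.
have kf : kappa mu p0 t \is a fin_num.
  by rewrite fin_num_abs (le_lt_trans h)// ltry.
by split => //; move: h; rewrite -[in X in X -> _](fineK kf) abse_EFin lee_fin.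
Qed.

Lemma kappa_sup_ge0 : 0 <= K.
Proof.
have [|_] := @kappa_le 0; first by rewrite normr0 ltW.
exact: le_trans.
Qed.

Let gA : g A = 1%E.
Proof.
have := probability_setC g (measurableC mA).
by rewrite setCK (msupport_null gm) sube0.
Qed.

Let me_ : measurable_fun [set: measurableTypeR R] (e : measurableTypeR R -> R).
Proof.
apply: measurableT_comp; first exact: measurable_expR.
apply: measurableT_comp; first exact: oppr_measurable.
apply: measurableT_comp; [exact: fine_measurable|exact: measurable_kappa].
Qed.

Let e_le t : A t -> expR (- K) <= e t <= expR K.
Proof.
move=> /A_le/kappa_le[_]; rewrite ler_norml => /andP[h1 h2].
by rewrite /e !ler_expR; lra.
Qed.

Lemma integrable_weight (f : R -> R) : continuous f ->
  g.-integrable A (EFin \o (fun t => f t * e t)).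
Proof.
move=> cf; apply: measurable_bounded_integrable => //.
- by rewrite [X in (X < _)%E](gA : _ = 1%E) ltry.
- apply: measurable_funTS; apply: measurable_funM => //.
  exact: continuous_measurable_fun.
have /(compact_bounded)[N [_ NP]] : compact (f @` `[- m, m]).
  apply: continuous_compact; first exact: continuous_subspaceT.
  exact: segment_compact.
(* Compactness bounds [|f|] by every number above [N], and [N] itself may be negative. *)
exists ((`|N| + 1) * expR K); split; first exact: num_real.
move=> B NB t At /=.
have := e_le At => /andP[_ eK].
apply: le_trans (ltW NB); rewrite normrM ler_pM//; last first.
  by rewrite ger0_norm ?expR_ge0.
apply: (NP (`|N| + 1)); last by exists t.
by rewrite (le_lt_trans (ler_norm _))// ltrDl.
Qed.

(** With [f t = expR (t * x)] this is [l_g(x)] as a real number. General [f] is allowed so that the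
    truncated series and its real part at complex points are integrated against the same weight. *)
Definition mixint (f : R -> R) : R := \int[g]_(t in A) (f t * e t).

Lemma mixint_le (f h : R -> R) : continuous f -> continuous h ->
  (forall t, `|t| <= m -> f t <= h t) -> mixint f <= mixint h.
Proof.
move=> cf ch fh; apply: le_Rintegral => //; [exact: integrable_weight..|].
by move=> t /A_le/fh; rewrite ler_pM2r// expR_gt0.
Qed.

Lemma mixintB (f h : R -> R) : continuous f -> continuous h ->
  mixint (fun t => f t - h t) = mixint f - mixint h.
Proof.
move=> cf ch; rewrite /mixint -RintegralB//; [|exact: integrable_weight..].
by apply: eq_Rintegral => t _; rewrite mulrBl.
Qed.

Lemma mixintZ (c : R) (f : R -> R) : continuous f ->
  mixint (fun t => c * f t) = c * mixint f.
Proof.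
move=> cf; rewrite /mixint -RintegralZl//; last exact: integrable_weight.
by apply: eq_Rintegral => t _; rewrite mulrA.
Qed.

Lemma mixint_sum (D : nat) (f : nat -> R -> R) : (forall k, continuous (f k)) ->
  mixint (fun t => \sum_(k < D) f k t) = \sum_(k < D) mixint (f k).
Proof.
move=> cf; elim: D => [|D IH].
  rewrite big_ord0 /mixint (_ : (fun _ => _) = fun t => 0 * e t).
    rewrite RintegralZl ?mul0r//.
    have := integrable_weight (@cst_continuous _ _ (1:R)).
    by apply: eq_integrable => // t _ /=; rewrite mul1r.
  by apply/funext => t; rewrite big_ord0.
rewrite big_ord_recr /= -IH /mixint -RintegralD//.
- by apply: eq_Rintegral => t _; rewrite big_ord_recr mulrDl.
- apply: integrable_weight; exact: continuous_sum_ord.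
- exact: integrable_weight.
Qed.

(** The weight is at least [expR (- K)] and [g] has mass 1 on [[- m, m]], so the integral is at
    least [c * expR (- K)]. *)
Lemma mixint_gt0 (f : R -> R) (c : R) : continuous f -> 0 < c ->
  (forall t, `|t| <= m -> c <= f t) -> 0 < mixint f.
Proof.
move=> cf c0 cP; apply: (@lt_le_trans _ _ (\int[g]_(t in A) (c * expR (- K)))).
  by rewrite Rintegral_cst// [X in fine X](gA : _ = 1%E) mulr1 mulr_gt0// expR_gt0.
apply: le_Rintegral => //.
- apply/integrableP; split => //.
    by apply/measurable_EFinP; exact: measurable_cst.
  by rewrite integral_cst// [X in (_ * X)%E](gA : _ = 1%E) mule1 ltry.
- exact: integrable_weight.
move=> t At; have /andP[h _] := e_le At.
by rewrite ler_pM ?expR_ge0 ?(ltW c0)// cP// A_le.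
Qed.

Lemma mixratioE (x : R) : mixratio mu p0 g x = (mixint (fun t => expR (t * x)))%:E.
Proof.
rewrite /mixratio (@integral_conull _ _ _ _ A) ?msupport_null//;
  last exact: measurable_tilt.
rewrite /mixint /Rintegral fineK; last first.
  apply: integrable_fin_num => //.
  apply: (integrable_weight (f := fun t => expR (t * x))).
  move=> t; apply: continuous_comp; last exact: continuous_expR.
  by apply: cvgM; [exact: cvg_id|exact: cvg_cst].
apply: eq_integral => t; rewrite inE => /A_le/kappa_le[kf _].
  by rewrite /tilt /e -expRD -[in LHS](fineK kf).
exact: msupport_null.
Qed.


Let continuous_expRM (x : R) : continuous (fun t : R => expR (t * x)).
Proof.
move=> t; apply: continuous_comp; last exact: continuous_expR.
by apply: cvgM; [exact: cvg_id|exact: cvg_cst].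
Qed.

Let continuous_series (D : nat) (u : nat -> R) :
  continuous (fun t : R => \sum_(k < D) t ^+ k / k`!%:R * u k).
Proof.
apply: (@continuous_sum_ord R D (fun k t => t ^+ k / k`!%:R * u k)) => k t.
apply: cvgM; last exact: cvg_cst.
by apply: cvgM; [exact: exprn_continuous|exact: cvg_cst].
Qed.

Lemma mixint_series (D : nat) (u : nat -> R) :
  mixint (fun t => \sum_(k < D) t ^+ k / k`!%:R * u k) =
  \sum_(k < D) mixint (fun t => t ^+ k) / k`!%:R * u k.
Proof.
rewrite (@mixint_sum D (fun k t => t ^+ k / k`!%:R * u k)); last first.
  move=> k t; apply: cvgM; last exact: cvg_cst.
  by apply: cvgM; [exact: exprn_continuous|exact: cvg_cst].
apply: eq_bigr => k _.
transitivity (mixint (fun t => (u k / k`!%:R) * t ^+ k)).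
  by congr mixint; apply/funext => t; ring.
by rewrite mixintZ; [ring|exact: exprn_continuous].
Qed.

Lemma mixint_expR_gt0 (x : R) : 0 < mixint (fun t => expR (t * x)).
Proof.
apply: (mixint_gt0 (c := expR (- (m * `|x|)))) => //; first exact: expR_gt0.
move=> t tm; rewrite ler_expR lerNl -mulNr.
apply: le_trans (ler_norm _) _; rewrite normrM normrN.
by rewrite ler_wpM2r.
Qed.

(** Truncating the series under the integral gives a polynomial [q] with [q(z)] the integral of
    [texp D (t z)]. It inherits closeness to [l_g] and positivity of the real part from the
    integrand, because the weight is positive. *)
Lemma ln_mixint_approx (X : R) (D n : nat) : 0 < X -> 1 <= X * m ->
  14 * (X * m) <= D%:R ->
  exists p : {poly R}, (size p <= n.+1)%N /\
    forall x, `|x| <= X ->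
      `|ln (mixint (fun t => expR (t * x))) - p.[x]| <=
        2 * expR (5 * (X * m) - D%:R) +
        D%:R * (8 * (X * m) * expR (- (n.+1%:R / (3 * (X * m))))).
Proof.
move=> X0 a1 aD.
have a0 : 0 < X * m by rewrite mulr_gt0.
pose q : {poly R} := \poly_(k < D) (mixint (fun t => t ^+ k) / k`!%:R).
have texpE (t x : R) : texp D (t * x) = \sum_(k < D) t ^+ k / k`!%:R * x ^+ k.
  by apply: eq_bigr => k _; rewrite exprMn; ring.
have qE x : q.[x] = mixint (fun t => texp D (t * x)).
  rewrite horner_poly -(mixint_series D (fun k => x ^+ k)).
  by congr mixint; apply/funext => t; rewrite texpE.
apply: (@ln_poly_approx_strip R X m D n q) => //; first exact: size_poly.
  move=> x xX; split; first exact: mixint_expR_gt0.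
  have ctexp : continuous (fun t : R => texp D (t * x)).
    by rewrite (_ : (fun t : R => texp D (t * x)) =
      fun t : R => \sum_(k < D) t ^+ k / k`!%:R * x ^+ k) //; apply/funext => t.
  have cexp : continuous (fun t : R => expR (t * x)) by exact: continuous_expRM.
  (* The truncation error is at most [expR (4 a - D)] with [a = X m]; one more [a] makes it
     relative, since [expR (t * x) >= expR (- a)]. *)
  have key t : `|t| <= m -> `|expR (t * x) - texp D (t * x)| <=
      expR (5 * (X * m) - D%:R) * expR (t * x).
    move=> tm; apply: le_trans (expR_sub_texp_le _ _) _.
    have : `|t * x| <= X * m by rewrite normrM mulrC ler_pM.
    rewrite -expRD ler_expR => txa.
    by move: (txa); rewrite [in X in X -> _]ler_norml => /andP[? ?]; lra.
  rewrite qE -mixintB// ler_norml; apply/andP; split.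
    rewrite -mulNr -mixintZ//; apply: mixint_le => //.
    - by move=> t; apply: cvgM; [exact: cvg_cst|exact: cexp].
    - by move=> t; apply: cvgB; [exact: cexp|exact: ctexp].
    - by move=> t /key; rewrite ler_norml mulNr => /andP[].
  rewrite -mixintZ//; apply: mixint_le => //.
  - by move=> t; apply: cvgB; [exact: cexp|exact: ctexp].
  - by move=> t; apply: cvgM; [exact: cvg_cst|exact: cexp].
  - by move=> t /key; rewrite ler_norml => /andP[].
move=> z zR zI; apply/eqP => /(congr1 (@complex.Re R)) qz0.
suff : 0 < Re (map_poly (real_complex R) q).[z] by rewrite qz0 ltxx.
have Reexp (t : R) : Re (texp D (t%:C%C * z)) =
    \sum_(k < D) t ^+ k / k`!%:R * Re (z ^+ k).
  rewrite Re_sum; apply: eq_bigr => k _; rewrite exprMn -ReZ; congr Re.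
  by rewrite rmorphM rmorphXn fmorphV rmorph_nat mulrAC.
pose f : R -> R := fun t => Re (texp D (t%:C%C * z)).
have fE : f = fun t : R => \sum_(k < D) t ^+ k / k`!%:R * Re (z ^+ k).
  by apply/funext => t; exact: Reexp.
have -> : Re (map_poly (real_complex R) q).[z] = mixint f.
  rewrite (@horner_coef_wide _ D); last by rewrite size_map_poly size_poly.
  rewrite Re_sum fE (mixint_series D (fun k => Re (z ^+ k))).
  by apply: eq_bigr => k _; rewrite coef_map coef_poly ltn_ord ReZ.
(* The lower bound of [Re_texp_ge], uniform in [|t| <= m]. *)
apply: (mixint_gt0 (c := expR (8 * (X * m) - D%:R) / 2)).
- by rewrite fE; exact: (continuous_series (u := fun k => Re (z ^+ k))).
- by rewrite divr_gt0// expR_gt0.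
rewrite /f.
move=> t tm.
have -> : t%:C%C * z = Complex (t * Re z) (t * Im z).
  by case: (z) => a b /=; apply/eqP; rewrite eq_complex /= !mul0r subr0 addr0 !eqxx.
apply: Re_texp_ge => //; rewrite normrM mulrC.
- by apply: le_trans zR; rewrite ler_wpM2l.
- by apply: le_trans zI; rewrite ler_wpM2l.
Qed.

End bounded_mixing.

(** Tonelli's theorem applies because the integration is over the probability [g]. *)
Lemma measurable_mixratio (g : probability (measurableTypeR R) R) :
  measurable_fun [set: measurableTypeR R]
    (mixratio mu p0 g : measurableTypeR R -> \bar R).
Proof.
pose f (xt : measurableTypeR R * measurableTypeR R) := tilt mu p0 xt.2 xt.1.
apply: (@measurable_fun_fubini_tonelli_F _ _ _ _ R g f).
- apply: measurableT_comp; first exact: measurable_expeR.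
  apply: emeasurable_funB; last by apply: measurableT_comp => //; exact: measurable_kappa.
  by apply/measurable_EFinP; apply: measurable_funM.
- by move=> xt; exact: tilt_ge0.
Qed.

End exponential_family.

(** * From quadrature errors to the likelihood gap, for a fixed sample *)

Section likelihood_gap.
Variables (R : realType) (mu : {measure set (measurableTypeR R) -> \bar R}).
Variables (p0 : R -> R) (s : seq R) (m : R).
Hypotheses (p0_density : is_density mu p0) (m0 : 0 < m).
Hypothesis kfin : kappa_sup mu p0 m \is a fin_num.
Implicit Types (g Q : probability (measurableTypeR R) R).

Let lr g (x : R) : R := mixint mu p0 m g (fun t => expR (t * x)).

(** The part due to [p0] is split off because it cancels between two mixtures. *)
Lemma loglik_mixdensE g : msupport g `<=` `[- m, m] -> {in s, forall x, 0 < p0 x} ->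
  loglik s (mixdens mu p0 g) =
  (\sum_(x <- s) ln (lr g x) + \sum_(x <- s) ln (p0 x))%:E.
Proof.
move=> gm sp0; rewrite /loglik -big_split /= -sumEFin big_seq [RHS]big_seq.
apply: eq_bigr => x xs.
have l0 := mixint_expR_gt0 p0_density gm kfin x.
rewrite (mixdensE p0_density) (mixratioE p0_density gm kfin) -EFinM.
by rewrite lne_EFin ?mulr_gt0 ?sp0// lnM ?posrE ?sp0.
Qed.

Lemma quad_lne_mixratioE Q (r : seq R) g : uniq r -> Q [set` r] = 1%E ->
  msupport g `<=` `[- m, m] ->
  (\int[Q]_x lne (mixratio mu p0 g x) =
   (\sum_(y <- r) fine (Q [set y]) * ln (lr g y))%:E)%E.
Proof.
move=> ur Qr gm.
have lE y : lne (mixratio mu p0 g y) = (ln (lr g y))%:E.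
  rewrite (mixratioE p0_density gm kfin) lne_EFin//.
  exact: (mixint_expR_gt0 p0_density gm kfin).
rewrite (integral_finite_support ur Qr).
- by congr EFin; apply: eq_bigr => y _; rewrite lE.
- apply: measurableT_comp; first exact: measurable_lne.
  exact: measurable_mixratio.
- by move=> y _; rewrite lE.
Qed.

Lemma absmax_ge : {in s, forall x, `|x| <= absmax s}.
Proof.
rewrite /absmax; elim: s => [//|y t IH] x; rewrite inE big_cons le_max.
by move=> /predU1P[->|/IH ->]; rewrite ?lexx ?orbT.
Qed.

(** The rule supplies the moments 1 to [2 J - 1]; the moment of order 0 is the total mass. Repeated
    nodes are removed so that no atom is counted twice. *)
Lemma gauss_quadrature_moments (J : nat) Q : (0 < J)%N -> (0 < size s)%N ->
  is_gauss_quadrature J s Q ->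
  exists r : seq R, [/\ uniq r, (size r <= J)%N, Q [set` r] = 1%E &
    forall k : nat, (k < 2 * J)%N ->
      \sum_(y <- r) fine (Q [set y]) * y ^+ k =
      (size s)%:R^-1 * \sum_(x <- s) x ^+ k].
Proof.
move=> J0 s0 [[r [rJ Qr]] mom _]; exists (undup r); split.
- exact: undup_uniq.
- by rewrite (leq_trans (size_undup _)).
- rewrite -Qr; congr (Q _); apply/seteqP.
  by split=> x /=; rewrite mem_undup.
have Qr' : Q [set` undup r] = 1%E.
  rewrite -Qr; congr (Q _); apply/seteqP.
  by split=> x /=; rewrite mem_undup.
move=> k kJ.
have mk : measurable_fun [set: measurableTypeR R]
    ((fun x => x ^+ k) : measurableTypeR R -> R).
  exact: measurable_funX.
have E := integral_finite_support (undup_uniq r) Qr' (f := fun x => (x ^+ k)%:E).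
have {}E : (\int[Q]_x (x ^+ k)%:E)%E =
    (\sum_(y <- undup r) fine (Q [set y]) * y ^+ k)%:E.
  by rewrite E//; exact/measurable_EFinP.
apply: EFin_inj; rewrite -E.
rewrite -(integral_empirical s mk).
case: k kJ mk E => [|k] kJ mk E; last by apply: mom; lia.
rewrite (integral_empirical s mk) big_const_seq count_predT iter_addr_0.
rewrite mulVf ?pnatr_eq0 -?lt0n//.
transitivity (\int[Q]_x (cst 1%:E) x)%E; first by apply: eq_integral.
by rewrite integral_cst// [X in (_ * X)%E](probability_setT Q) mule1.
Qed.

(** Passing from the quadrature mean to the sample mean costs [2 * eps] for [g] and for [h], so the
    gap is at most [n * (4 * eps)], which [tolerance_le] bounds. *)
Lemma loglik_gap_le (Delta : R) (J : nat) Q g h : (0 < size s)%N -> 0 < Delta ->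
  {in s, forall x, 0 < p0 x} ->
  is_gauss_quadrature J s Q -> (0 < J)%N ->
  msupport g `<=` `[- m, m] -> msupport h `<=` `[- m, m] ->
  (\int[Q]_x lne (mixratio mu p0 g x) <= \int[Q]_x lne (mixratio mu p0 h x))%E ->
  let a := absmax s * m in
  let L := 600 * (size s)%:R * a * (a + fine (kappa_sup mu p0 m)) / Delta in
  1 <= a -> 1 < L -> 2 * a * ln L <= J%:R ->
  (loglik s (mixdens mu p0 g) - loglik s (mixdens mu p0 h) <= Delta%:E)%E.
Proof.
move=> s0 D0 sp0 Qquad J0 gm hm Qgh a L a1 L1 aJ.
have X0 : 0 < absmax s.
  by rewrite -(pmulr_lgt0 _ m0); apply: lt_le_trans a1.
have [r [ur rJ Qr mom]] := gauss_quadrature_moments J0 s0 Qquad.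
(* The number of terms of the exponential series; [D <= 15 a + ln L] because [a >= 1]. *)
pose D := (Num.truncn (14 * a + ln L)).+1.
have y0 : 0 < ln L by rewrite ln_gt0.
have [D1 D2] : 14 * a + ln L <= D%:R /\ D%:R <= 15 * a + ln L.
  have := @truncn_itv R (14 * a + ln L); rewrite -/D => /(_ _)/andP[]; first by lra.
  by rewrite /D -natr1; lra.
have D3 : 14 * a <= D%:R by lra.
pose W y := fine (Q [set y]).
have W0 y : 0 <= W y by apply: fine_ge0.
have W1 : \sum_(y <- r) W y = 1.
  have := mom 0%N; rewrite muln_gt0 J0 => /(_ isT).
  rewrite [in RHS]big_const_seq count_predT iter_addr_0 mulVf ?pnatr_eq0 -?lt0n//.
  by move=> <-; apply: eq_bigr => y _; rewrite expr0 mulr1.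
(* Exactness covers degree at most [2 J - 1], that is, size at most [2 J]. *)
have J2 : (2 * J).-1.+1 = (2 * J)%N by rewrite prednK// muln_gt0 J0.
pose eps := 2 * expR (5 * a - D%:R) +
  D%:R * (8 * a * expR (- ((2 * J)%:R / (3 * a)))).
have err g' : msupport g' `<=` `[- m, m] ->
   `|\sum_(y <- r) W y * ln (lr g' y) - (size s)%:R^-1 * \sum_(x <- s) ln (lr g' x)|
     <= 2 * eps.
  move=> g'm.
  have [p []] := ln_mixint_approx p0_density m0 g'm kfin (2 * J).-1 X0 a1 D3.
  rewrite J2 => sp pP.
  exact: (quad_error_le ur rJ s0 W0 mom W1 absmax_ge sp pP).
have tol := tolerance_le s0 a1 (kappa_sup_ge0 m0 kfin) D0 L1 D1 D2 aJ.
have := err _ gm; have := err _ hm.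
move: Qgh; rewrite !(quad_lne_mixratioE ur Qr)// lee_fin -/W.
rewrite !loglik_mixdensE// -EFinB lee_fin opprD addrACA subrr addr0.
set Sg := \sum_(x <- s) ln (lr g x); set Sh := \sum_(x <- s) ln (lr h x).
rewrite !ler_norml => QQ /andP[h1 h2] /andP[g1 g2].
have n0 : 0 < (size s)%:R :> R by rewrite ltr0n.
apply: le_trans tol; rewrite -/eps -ler_pdivrMl// mulrBr; lra.
Qed.

End likelihood_gap.

(** * The likelihood gap for a random sample *)

Theorem theorem2p1 (R : realType) :
  exists C : R, 0 < C /\
  forall (mu : {measure set (measurableTypeR R) -> \bar R}) (p0 : R -> R)
    (M : \bar R),
    is_density mu p0 -> (0 < M)%E -> Theta0 M `<=` Theta mu p0 ->
  forall (g0 : probability (measurableTypeR R) R), mixing M g0 ->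
  forall (d : measure_display) (Omega : measurableType d)
    (P : probability Omega R)
    (Delta : nat -> R) (Mseq : nat -> Omega -> R),
    (forall n, (0 < n)%N -> 0 < Delta n) ->
    (forall n w, (0 < n)%N -> 0 < Mseq n w) ->
  forall (n : nat) (X : 'I_n -> {RV P >-> R}),
    (0 < n)%N -> iid_sample mu (mixdens mu p0 g0) X ->
  forall (J : Omega -> nat)
    (PJ ghat ghatJ : Omega -> probability (measurableTypeR R) R),
    {ae P, forall w,
      let s := [seq X i w | i : 'I_n] in
      let Xn := absmax s in
      let Mn := Mseq n w in
      is_npmle mu p0 M s (ghat w) ->
      is_gauss_quadrature (J w) s (PJ w) ->
      is_quad_npmle mu p0 M (PJ w) (ghatJ w) ->
      msupport (ghat w) `|` msupport (ghatJ w) `<=` `[- Mn, Mn] ->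
      1 <= Xn * Mn ->
      (0 < J w)%N ->
      kappa_sup mu p0 Mn \is a fin_num ->
      (J w)%:Z = Num.ceil (2 * Xn * Mn *
        ln (C * n%:R * Xn * Mn * (Xn * Mn + fine (kappa_sup mu p0 Mn))
            / Delta n)) ->
      (loglik s (mixdens mu p0 (ghat w)) - loglik s (mixdens mu p0 (ghatJ w))
        <= (Delta n)%:E)%E}.
Proof.
exists 600; split; first by rewrite ltr0n.
move=> mu p0 M p0_density _ _ g0 _ d Omega P Delta Mseq D0 M0
  n X n0 [_ Xdens] J PJ ghat ghatJ.
(* The exceptional null set: outside it [p0] is positive at all observations. *)
have : {ae P, forall w, forall i, 0 < p0 (X i w)}.
  by apply: filter_forall => i; exact: has_density_p0_gt0 (Xdens i).
apply: filterS => w Xp0 /=.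
set s := [seq X i w | i : 'I_n]; set Xn := absmax s; set Mn := Mseq n w.
move=> [mixg _] Qquad [_ Qmax] supp a1 J0 kfin JE.
have ss : size s = n by rewrite size_map -cardE card_ord.
set a := Xn * Mn in a1.
have a0 : 0 < a by lra.
set K := fine _ in JE.
have K0 : 0 <= K by apply: kappa_sup_ge0; first exact: M0.
have D0n := D0 _ n0.
pose L := 600 * (size s)%:R * a * (a + K) / Delta n.
have LE : 600 * n%:R * Xn * Mn * (Xn * Mn + K) / Delta n = L.
  by rewrite /L ss /a; ring.
rewrite LE -[2 * Xn * Mn]mulrA -/a in JE.
have J2 : 2 * a * ln L <= (J w)%:R.
  by rewrite (_ : (J w)%:R = (J w)%:Z%:~R)// JE ceil_ge.
(* As [J w] is a positive integer, the ceiling is positive, which forces [L > 1]. *)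
have lnL0 : 0 < ln L.
  have : 0 < 2 * a * ln L by rewrite -ceil_gt0 -JE.
  by rewrite pmulr_rgt0// mulr_gt0.
have L1 : 1 < L by rewrite ltNge; apply: contraTN lnL0 => /ln_le0; rewrite leNgt.
apply: (loglik_gap_le p0_density (M0 n w n0) kfin _ _ _ Qquad J0) => //.
- by rewrite ss.
- by move=> x /mapP[i _ ->].
- by apply: subset_trans supp; exact: subsetUl.
- by apply: subset_trans supp; exact: subsetUr.
(* [ghat w] is a competitor in the maximization that defines [ghatJ w]. *)
- exact: Qmax mixg.
Qed.
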